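(* Let $d,m\in\mathbb{N}$, and let $\Sigma$ and $\Omega$ be given real symmetric positive definite matrices of sizes $d\times d$ and $m\times m$, respectively. If $X\sim T_{d,m}(\nu,\Sigma,\Omega)$ (centered matrix-variate $T$ distribution with $\nu$ degrees of freedom) and $\Delta_X:=\Sigma^{-1/2}X\Omega^{-1/2}$, then $$\mathbb{E}\big[\mathrm{tr}(\Delta_X\Delta_X^{\top})\big]=\frac{md\,\nu}{\nu-2},$$ $$\mathbb{E}\big[\mathrm{tr}\big((\Delta_X\Delta_X^{\top})^2\big)\big]=\frac{md\,\nu^2\{(m+d)(\nu-2)+\nu+md\}}{(\nu-1)(\nu-2)(\nu-4)}.$$ In particular, as $\nu\to\infty$, $$\mathbb{E}\big[\mathrm{tr}(\Delta_X\Delta_X^{\top})\big]\sim md\quad\text{and}\quad\mathbb{E}\big[\mathrm{tr}\big((\Delta_X\Delta_X^{\top})^2\big)\big]\sim md(m+d+1).$$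
   Context: $|\cdot|$ denotes the determinant and $\mathrm{tr}$ the trace; $\Sigma^{-1/2}$, $\Omega^{-1/2}$ are the inverses of the symmetric positive definite square roots; $a\sim b$ means $a=(1+o(1))b$ as $\nu\to\infty$. For $\nu>0$, $T_{d,m}(\nu,\Sigma,\Omega)$ is the distribution on $\mathbb{R}^{d\times m}$ with density $$K_{\nu,\Sigma,\Omega}(X) := \frac{\Gamma_d(\frac12(\nu+m+d-1))}{\Gamma_d(\frac12(\nu+d-1))}\,\frac{|\mathrm{I}_d+\nu^{-1}\Sigma^{-1}X\Omega^{-1}X^{\top}|^{-(\nu+m+d-1)/2}}{(\nu\pi)^{md/2}|\Sigma|^{m/2}|\Omega|^{d/2}},\quad X\in\mathbb{R}^{d\times m},$$ where $\Gamma_d(z)=\pi^{d(d-1)/4}\prod_{j=1}^d\Gamma\big(z-\frac{j-1}{2}\big)$, $\Re(z)>\frac{d-1}{2}$, is the multivariate gamma function, $\Gamma$ is the classical gamma function and $\mathrm{I}_d$ is the $d\times d$ identity matrix.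
   Formalization: The first expectation formula is stated for ν > 2 and the second for ν > 4, since for smaller ν > 0 the expectations are infinite and the formulas fail (e.g. d = m = 1, ν = 1 gives E = +∞, not −1). *)

(* Defs.v *)
From HB Require Import structures.
From mathcomp Require Import all_boot all_order all_algebra.
From mathcomp Require Import all_classical all_reals all_analysis.
Import Order.TTheory GRing.Theory Num.Theory.
Import numFieldNormedType.Exports.

Set Implicit Arguments.
Unset Strict Implicit.
Unset Printing Implicit Defensive.

Local Open Scope classical_set_scope.
Local Open Scope ring_scope.

(* Borel sigma-algebra of the space of d x m real matrices: the product
   sigma-algebra, generated by the d * m coordinate functions. *)
Definition mx_coord_sets (R : realType) (d m : nat) : set (set 'M[R]_(d, m)) :=
  [set B | exists (i : 'I_d) (j : 'I_m) (A : set R),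
      measurable A /\ B = (fun X : 'M[R]_(d, m) => X i j) @^-1` A].

Definition measurable_mx (R : realType) (d m : nat) : set (set 'M[R]_(d, m)) :=
  <<s @mx_coord_sets R d m >>.

Section measurable_mx_instance.
Context (R : realType) (d m : nat).

Let measurable_mx0 : @measurable_mx R d m set0.
Proof. exact: sigma_algebra0. Qed.

Let measurable_mxC A : @measurable_mx R d m A -> @measurable_mx R d m (~` A).
Proof. exact: sigma_algebraC. Qed.

Let measurable_mx_bigcup (F : (set 'M[R]_(d, m))^nat) :
  (forall i, @measurable_mx R d m (F i)) ->
  @measurable_mx R d m (\bigcup_i (F i)).
Proof. exact: sigma_algebra_bigcup. Qed.

HB.instance Definition _ :=
  @isMeasurable.Build default_measure_display 'M[R]_(d, m)
    (@measurable_mx R d m) measurable_mx0 measurable_mxC measurable_mx_bigcup.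

End measurable_mx_instance.

Section measurable_mx_theory.
Context (R : realType) (d m : nat).

Lemma measurable_mx_coord (i : 'I_d) (j : 'I_m) :
  measurable_fun [set: 'M[R]_(d, m)] (fun X : 'M[R]_(d, m) => X i j).
Proof.
move=> _ A mA; rewrite setTI; apply: sub_sigma_algebra.
by exists i, j, A.
Qed.

Lemma measurable_fun_mx d1 (T1 : measurableType d1) (f : T1 -> 'M[R]_(d, m)) :
  (forall i j, measurable_fun setT (fun x => f x i j)) ->
  measurable_fun setT f.
Proof.
move=> mf; apply: (measurability (@mx_coord_sets R d m)) => //.
move=> _ [_ [i [j [A [mA ->]]]] <-].
by rewrite setTI -comp_preimage -[X in measurable X]setTI; exact: mf.
Qed.

End measurable_mx_theory.

Section measure_of_sigma_finite.
Context d (T : measurableType d) (R : realType).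
Variable mu : {measure set T -> \bar R}.
Hypothesis muT : sigma_finite setT mu.

(* mu itself, packed with the proof that it is sigma-finite *)
Definition measure_of_sigma_finite : set T -> \bar R := let _ := muT in mu.

HB.instance Definition _ := isMeasure.Build _ _ _ measure_of_sigma_finite
  (measure0 mu) (measure_ge0 mu) (@measure_semi_sigma_additive _ _ _ mu).

HB.instance Definition _ :=
  Measure_isSigmaFinite.Build _ _ _ measure_of_sigma_finite muT.

End measure_of_sigma_finite.

Section pushforward_sigma_finite.
Local Open Scope ereal_scope.

Lemma sigma_finite_product_measure1 d1 d2 (T1 : measurableType d1)
    (T2 : measurableType d2) (R : realType)
    (m1 : {sigma_finite_measure set T1 -> \bar R})
    (m2 : {sigma_finite_measure set T2 -> \bar R}) :
  sigma_finite setT (m1 \x m2).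
Proof.
have /sigma_finiteP[F [TF ndF Foo]] := sigma_finiteT m1.
have /sigma_finiteP[G [TG ndG Goo]] := sigma_finiteT m2.
exists (fun n => F n `*` G n).
  rewrite -setXTT TF TG predeqE => -[x y]; split.
    move=> [/= [n _ Fnx] [k _ Gky]]; exists (maxn n k) => //; split.
    - by move: x Fnx; exact/subsetPset/ndF/leq_maxl.
    - by move: y Gky; exact/subsetPset/ndG/leq_maxr.
  by move=> [n _ []/= ? ?]; split; exists n.
move=> k; have [? ?] := Foo k; have [? ?] := Goo k.
split; first exact: measurableX.
by rewrite product_measure1E// lte_mul_pinfty// ge0_fin_numE.
Qed.

Lemma sigma_finite_pushforward d1 d2 (T1 : measurableType d1)
    (T2 : measurableType d2) (R : realType)
    (mu : {sigma_finite_measure set T1 -> \bar R})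
    (f : T1 -> T2) (g : T2 -> T1) :
  measurable_fun setT f -> measurable_fun setT g -> cancel f g ->
  exists nu : {sigma_finite_measure set T2 -> \bar R},
    pushforward mu f = nu :> (set T2 -> \bar R).
Proof.
move=> mf mg fK.
have [m0 m0E] : exists m0 : {measure set T2 -> \bar R},
    pushforward mu f = m0 :> (set T2 -> \bar R).
  by unshelve eexists; [refine (pushforward mu f : {measure set T2 -> \bar R})|].
have sf : sigma_finite setT m0.
  have [F FT mF] := sigma_finiteT mu.
  exists (fun k => g @^-1` F k); first by rewrite -preimage_bigcup -FT preimage_setT.
  move=> k; split.
    by rewrite -[X in measurable X]setTI; apply: mg => //; exact: (mF k).1.
  rewrite -m0E /pushforward -comp_preimage.
  rewrite (_ : g \o f = id) ?preimage_id; first exact: (mF k).2.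
  by apply/funext => x /=; exact: fK.
by exists (measure_of_sigma_finite sf); rewrite m0E.
Qed.

End pushforward_sigma_finite.

Section lebesgue_mx.
Local Open Scope ereal_scope.
Context (R : realType).
Notation RT := (measurableTypeR R).

Definition cons_tuple_pair (n : nat) (p : RT * n.-tuple RT) : n.+1.-tuple RT :=
  [the n.+1.-tuple RT of p.1 :: p.2].

(* Lebesgue measure on R^n, as an iterated product of the measure on R *)
Fixpoint lebesgue_tuple (n : nat) : set (n.-tuple RT) -> \bar R :=
  match n with
  | 0 => dirac [tuple]
  | k.+1 => pushforward (lebesgue_measure \x @lebesgue_tuple k)
              (@cons_tuple_pair k)
  end.

Definition tuple_mx (d m : nat) (t : (d * m).-tuple RT) : 'M[R]_(d, m) :=
  \matrix_(i < d, j < m) tnth t (mxvec_index i j).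

Definition lebesgue_mx (d m : nat) : set 'M[R]_(d, m) -> \bar R :=
  pushforward (@lebesgue_tuple (d * m)) (@tuple_mx d m).

Lemma measurable_cons_tuple_pair n :
  measurable_fun setT (@cons_tuple_pair n).
Proof. exact: measurable_cons. Qed.

Lemma lebesgue_tuple_sigma_finite n :
  exists mu : {sigma_finite_measure set (n.-tuple RT) -> \bar R},
    @lebesgue_tuple n = mu :> (set (n.-tuple RT) -> \bar R).
Proof.
elim: n => [|n [mu muE]]; first by exists (dirac [tuple]).
have [|||nu nuE] := @sigma_finite_pushforward _ _ _ _ R
    (measure_of_sigma_finite
      (sigma_finite_product_measure1 (@lebesgue_measure R) mu))
    (@cons_tuple_pair n)
    (fun t => (thead t, [tuple of behead t])).
- exact: measurable_cons_tuple_pair.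
- by apply: measurable_fun_pair; [exact: measurable_tnth|exact: measurable_behead].
- by move=> [x t]; congr pair; apply: val_inj.
- by exists nu; rewrite /= muE nuE.
Qed.

Lemma measurable_tuple_mx d m : measurable_fun setT (@tuple_mx d m).
Proof.
apply: measurable_fun_mx => i j.
rewrite (_ : (fun x => _) = (fun t => tnth t (mxvec_index i j))).
  exact: measurable_tnth.
by apply/funext => t; rewrite mxE.
Qed.

Lemma lebesgue_mx_sigma_finite d m :
  exists mu : {sigma_finite_measure set 'M[R]_(d, m) -> \bar R},
    @lebesgue_mx d m = mu :> (set 'M[R]_(d, m) -> \bar R).
Proof.
have [mu muE] := @lebesgue_tuple_sigma_finite (d * m).
pose g (X : 'M[R]_(d, m)) : (d * m).-tuple RT := [tuple mxvec X ord0 k | k < d * m].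
have [||nu nuE] := sigma_finite_pushforward mu (@measurable_tuple_mx d m) (g := g).
- apply/measurable_fun_tnthP => k.
  case/mxvec_indexP: k => i j.
  rewrite (_ : _ \o _ = fun X : 'M[R]_(d, m) => X i j).
    exact: measurable_mx_coord.
  by apply/funext => X /=; rewrite tnth_mktuple mxvecE.
- move=> t; apply: eq_from_tnth => k.
  by case/mxvec_indexP: k => i j; rewrite tnth_mktuple mxvecE mxE.
by exists nu; rewrite /lebesgue_mx muE nuE.
Qed.

Section instances.
Context (d m : nat).

Let lebesgue_mx0 : @lebesgue_mx d m set0 = 0.
Proof. by have [mu ->] := lebesgue_mx_sigma_finite d m. Qed.

Let lebesgue_mx_ge0 A : 0 <= @lebesgue_mx d m A.
Proof. by have [mu ->] := lebesgue_mx_sigma_finite d m. Qed.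

Let lebesgue_mx_sigma_additive : semi_sigma_additive (@lebesgue_mx d m).
Proof.
have [mu ->] := lebesgue_mx_sigma_finite d m.
exact: measure_semi_sigma_additive.
Qed.

HB.instance Definition _ := isMeasure.Build _ _ _ (@lebesgue_mx d m)
  lebesgue_mx0 lebesgue_mx_ge0 lebesgue_mx_sigma_additive.

Let lebesgue_mx_sigma_finiteT : sigma_finite setT (@lebesgue_mx d m).
Proof.
have [mu ->] := lebesgue_mx_sigma_finite d m; exact: sigma_finiteT.
Qed.

HB.instance Definition _ := @Measure_isSigmaFinite.Build _ _ _
  (@lebesgue_mx d m) lebesgue_mx_sigma_finiteT.

End instances.

Lemma lebesgue_tuple_box n (A : 'I_n -> set R) :
  (forall i, measurable (A i)) ->
  @lebesgue_tuple n [set t | forall i, A i (tnth t i)] =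
  \prod_(i < n) lebesgue_measure (A i).
Proof.
elim: n A => [|n IHn] A mA.
  by rewrite big_ord0 /= diracE mem_set //= => -[].
have [mu muE] := @lebesgue_tuple_sigma_finite n.
rewrite big_ord_recl -(IHn (fun i => A (lift ord0 i))) //= muE /pushforward.
set B := [set t | forall i, A (lift ord0 i) (tnth t i)].
have mB : measurable B.
  have -> : B = \bigcap_(i in [set: 'I_n])
      ((fun t => tnth t i) @^-1` A (lift ord0 i)).
    by apply/seteqP; split => t /= tB i; [move=> _; exact: tB|exact: (tB i I)].
  apply: fin_bigcap_measurable => // i _; rewrite -[X in measurable X]setTI.
  exact: measurable_tnth.
rewrite -(product_measure1E lebesgue_measure mu (mA ord0) mB).
congr product_measure1.
apply/seteqP; split => -[x t] /=.
  move=> h; split; first exact: (h ord0).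
  by move=> i; have := h (lift ord0 i); rewrite tnthS.
move=> [Ax Bt] i; case: (unliftP ord0 i) => [j|] -> //.
by rewrite tnthS; exact: Bt.
Qed.

Lemma lebesgue_mx_box d m (A : 'I_d -> 'I_m -> set R) :
  (forall i j, measurable (A i j)) ->
  @lebesgue_mx d m [set X | forall i j, A i j (X i j)] =
  \prod_(i < d) \prod_(j < m) lebesgue_measure (A i j).
Proof.
move=> mA.
pose ij (k : 'I_(d * m)) : 'I_d * 'I_m := enum_val (cast_ord (esym (mxvec_cast d m)) k).
have ijE i j : ij (mxvec_index i j) = (i, j).
  by rewrite /ij cast_ordK enum_rankK.
rewrite pair_big /= (reindex ij) /=; last first.
  exists (fun p => mxvec_index p.1 p.2) => [k _|[i j] _]; last exact: ijE.
  by case/mxvec_indexP: k => i j; rewrite ijE.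
rewrite -(lebesgue_tuple_box (A := fun k => A (ij k).1 (ij k).2)) //.
rewrite /lebesgue_mx /pushforward; congr lebesgue_tuple.
apply/seteqP; split => t /= h.
  by move=> k; case/mxvec_indexP: k => i j; have := h i j; rewrite mxE ijE.
by move=> i j; have := h (mxvec_index i j); rewrite mxE ijE.
Qed.

End lebesgue_mx.

(* The classical gamma function, through Euler's integral (0 < z). *)
Definition Gamma_fun (R : realType) (z : R) : R :=
  (\int[lebesgue_measure]_(t in `]0, +oo[) (t `^ (z - 1) * expR (- t)))%R.

Definition mvGamma_fun (R : realType) (d : nat) (z : R) : R :=
  pi `^ (d%:R * (d%:R - 1) / 4) *
  \prod_(1 <= j < d.+1) Gamma_fun (z - (j%:R - 1) / 2).

Definition posdefmx (R : realType) (n : nat) (A : 'M[R]_n) : Prop :=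
  A^T = A /\ forall v : 'cV[R]_n, v != 0 -> 0 < (v^T *m A *m v) 0 0.

(* A^{1/2}: the symmetric positive definite B such that B *m B = A; it exists
   and is unique when A is symmetric positive definite. *)
Definition sqrtmx (R : realType) (n : nat) (A : 'M[R]_n) : 'M[R]_n :=
  xget 0 [set B | posdefmx B /\ B *m B = A].

Section matrix_T.
Context (R : realType) (d m : nat).
Implicit Types (nu : R) (Sigma : 'M[R]_d) (Omega : 'M[R]_m) (X : 'M[R]_(d, m)).

(* All determinants below are positive when Sigma and Omega are positive
   definite, so that the real powers are the usual ones. *)
Definition matrixT_pdf nu Sigma Omega X : R :=
  mvGamma_fun d ((nu + m%:R + d%:R - 1) / 2) /
  mvGamma_fun d ((nu + d%:R - 1) / 2) *
  ((\det (1%:M + nu^-1 *: (invmx Sigma *m X *m invmx Omega *m X^T)))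
     `^ (- ((nu + m%:R + d%:R - 1) / 2)) /
   ((nu * pi) `^ (m%:R * d%:R / 2) *
    (\det Sigma) `^ (m%:R / 2) * (\det Omega) `^ (d%:R / 2))).

(* X follows T_{d,m}(nu, Sigma, Omega): its law has density matrixT_pdf with
   respect to Lebesgue measure. *)
Definition has_matrixT_law disp (T : measurableType disp) (P : probability T R)
    (X : {RV P >-> 'M[R]_(d, m)}) nu Sigma Omega : Prop :=
  forall A : set 'M[R]_(d, m), measurable A ->
    distribution P X A =
    (\int[@lebesgue_mx R d m]_(Y in A) (matrixT_pdf nu Sigma Omega Y)%:E)%E.

Definition Delta Sigma Omega X : 'M[R]_(d, m) :=
  invmx (sqrtmx Sigma) *m X *m invmx (sqrtmx Omega).

Definition DeltaDeltaT Sigma Omega X : 'M[R]_d :=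
  Delta Sigma Omega X *m (Delta Sigma Omega X)^T.

End matrix_T.

(* a ~ b at +oo, in the form a = (1 + o(1)) b *)
Definition asymp_equiv (R : realType) (a : R -> \bar R) (b : R -> R) : Prop :=
  exists2 eps : R -> R, eps nu @[nu --> +oo] --> 0 &
    \forall nu \near +oo, a nu = ((1 + eps nu) * b nu)%:E.

(* Main.v *)
From HB Require Import structures.
Require Import Defs.
From mathcomp Require Import all_boot all_order all_algebra.
From mathcomp Require Import all_classical all_reals all_analysis.
From mathcomp Require Import perm measurable_realfun ring lra.
From mathcomp.real_closed Require Import complex.
Import Order.TTheory GRing.Theory Num.Theory.
Import numFieldNormedType.Exports.

Set Implicit Arguments.
Unset Strict Implicit.
Unset Printing Implicit Defensive.

Local Open Scope classical_set_scope.
Local Open Scope ring_scope.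

(** Whitening by [X -> Sigma^(-1/2) X Omega^(-1/2)] maps Lebesgue measure to a
    translation-invariant measure and the law of [X] to a probability [Q] whose
    density is a constant times [det(W)^(-a)], where [W = I + S / nu],
    [S = X X^T] and [2 a = nu + m + d - 1].  The gradient of the logarithm of
    this density is [- (2 a / nu) W^-1 X], so integrating by parts against a
    vector field [G = W K] gives [E(div G) = (2 a / nu) E(tr(K X^T))].
    - [K = X] gives [(nu - 2) E(tr S) = nu m d];
    - [K = (nu - 2) S X + tr(S) X] is chosen so that the [(tr S)^2] terms cancel,
      and gives [(nu - 1) (nu - 4) E(tr S^2) = nu b E(tr S)] with
      [b = (m + d + 1) (nu - 2) + m d + 2].
    The moments are not known to be finite beforehand, so the integration by
    parts is made with [exp(- delta tr S) G]; the extra term it produces has a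
    sign, which bounds the moments uniformly in [delta], and is then dominated
    as [delta] tends to 0.  Only translation invariance is used to integrate by
    parts, and the value of the normalizing constant plays no role. *)

(** * Translation invariance of Lebesgue measure *)

Section translation.
Context (R : realType).
Notation RT := (measurableTypeR R).
Local Open Scope ereal_scope.

Lemma pushforward_is_measure d1 d2 (T1 : measurableType d1)
    (T2 : measurableType d2) (mu : {measure set T1 -> \bar R}) (f : T1 -> T2) :
  measurable_fun setT f ->
  exists m : {measure set T2 -> \bar R},
    pushforward mu f = m :> (set T2 -> \bar R).
Proof.
move=> mf.
by unshelve eexists; [refine (pushforward mu f : {measure set T2 -> \bar R})|].
Qed.

Lemma lebesgue_measure_shift (h : R) (A : set R) : measurable A ->
  lebesgue_measure ((fun x : R => (x + h)%R) @^-1` A) = lebesgue_measure A.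
Proof.
move=> mA.
have mf : measurable_fun setT (fun x : RT => (x + h)%R : RT).
  exact: measurable_realfun.measurable_funD.
have [m mE] := pushforward_is_measure lebesgue_measure mf.
rewrite -[LHS]/(pushforward _ _ _) [LHS](congr1 (@^~ A) mE).
apply/esym/lebesgue_measure_unique => //= _ [[a b]] _ <-.
rewrite -[RHS](congr1 (@^~ _) mE) /= /pushforward /=.
rewrite (_ : _ @^-1` _ = `](a - h)%R, (b - h)%R]%classic); last first.
  by apply/seteqP; split=> x /=; rewrite !in_itv /= ltrBlDr lerBrDr.
rewrite !lebesgue_measure_itv/= !lte_fin ltrD2r -!EFinB; case: ifP => // _.
by congr EFin; rewrite opprB addrA subrK.
Qed.

Lemma lebesgue_tuple_shift n (h : 'I_n -> R) (A : set (n.-tuple RT)) :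
  measurable A ->
  @lebesgue_tuple R n ((fun t => [tuple (tnth t i + h i)%R | i < n]) @^-1` A) =
  @lebesgue_tuple R n A.
Proof.
elim: n h A => [|n IHn] h A mA.
  rewrite (_ : _ @^-1` _ = A)//; apply/seteqP; split => t /=;
    by rewrite (tuple0 t) (tuple0 (mktuple _)).
have [mu muE] := @lebesgue_tuple_sigma_finite R n.
rewrite /= muE /pushforward.
pose s0 (x : RT) : RT := (x + h ord0)%R.
pose s1 (t : n.-tuple RT) : n.-tuple RT :=
  [tuple (tnth t i + h (lift ord0 i))%R | i < n].
have ms0 : measurable_fun setT s0 by exact: measurable_realfun.measurable_funD.
have ms1 : measurable_fun setT s1.
  apply/measurable_fun_tnthP => k; rewrite (_ : _ \o _ =
      fun t : n.-tuple RT => (tnth t k + h (lift ord0 k))%R); last first.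
    by apply/funext => t /=; rewrite tnth_mktuple.
  apply: measurable_realfun.measurable_funD => //; exact: measurable_tnth.
pose s (p : RT * n.-tuple RT) := (s0 p.1, s1 p.2).
have ms : measurable_fun setT s.
  by apply: measurable_fun_pair; apply: measurableT_comp.
have -> : @cons_tuple_pair R n @^-1`
    ((fun t => [tuple (tnth t i + h i)%R | i < n.+1]) @^-1` A) =
    s @^-1` (@cons_tuple_pair R n @^-1` A).
  apply/seteqP; split => -[x t] /=; rewrite (_ : mktuple _ =
    cons_tuple_pair (s (x, t)))//; apply: eq_from_tnth => i;
    rewrite tnth_mktuple; case: (unliftP ord0 i) => [j|] ->//;
    by rewrite /= !tnthS tnth_mktuple.
set B := cons_tuple_pair (n:=n) @^-1` A.
have mB : measurable B.
  by rewrite -[B]setTI; exact: measurable_cons_tuple_pair.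
have [m mE] := pushforward_is_measure (lebesgue_measure \x mu) ms.
rewrite -[LHS]/(pushforward _ _ _) [LHS](congr1 (@^~ B) mE).
apply/esym/product_measure_unique => // C D mC mD.
rewrite -[LHS](congr1 (@^~ _) mE) /= /pushforward /=.
rewrite (_ : _ @^-1` _ = (s0 @^-1` C) `*` (s1 @^-1` D))//.
rewrite product_measure1E//; first last.
- by rewrite -[X in measurable X]setTI; exact: ms1.
- by rewrite -[X in measurable X]setTI; exact: ms0.
congr (_ * _); first exact: lebesgue_measure_shift.
by rewrite -muE IHn.
Qed.

Lemma lebesgue_mx_shift d m (H : 'M[R]_(d, m)) (A : set 'M[R]_(d, m)) :
  measurable A ->
  @lebesgue_mx R d m ((fun X => (X + H)%R) @^-1` A) = @lebesgue_mx R d m A.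
Proof.
move=> mA; rewrite /lebesgue_mx /pushforward.
have mB : measurable (@tuple_mx R d m @^-1` A).
  by rewrite -[X in measurable X]setTI; exact: measurable_tuple_mx.
rewrite -[RHS](lebesgue_tuple_shift (fun k => mxvec H ord0 k))//.
congr lebesgue_tuple; apply/seteqP; split => t /=;
  rewrite (_ : tuple_mx (mktuple _) = (tuple_mx t + H)%R)//;
  by apply/matrixP => i j; rewrite !mxE tnth_mktuple mxvecE.
Qed.

End translation.

(** * Square roots of positive definite matrices *)

Lemma interpolation (F : fieldType) (s : seq F) (f : F -> F) :
  uniq s -> exists r : {poly F}, {in s, forall x, r.[x] = f x}.
Proof.
elim: s => [|x s IHs] /= ; first by exists 0.
move=> /andP[xs /IHs[r rE]].
pose w : {poly F} := \prod_(y <- s) ('X - y%:P).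
have wx : w.[x] != 0.
  by rewrite -rootE root_prod_XsubC.
exists (r + ((f x - r.[x]) / w.[x])%:P * w) => y; rewrite inE => /predU1P[->|ys].
  by rewrite !hornerE divfK// addrC subrK.
have /eqP wy : root w y by rewrite root_prod_XsubC.
by rewrite !hornerE wy mulr0 addr0 rE.
Qed.

Lemma posdefmx_unitmx (R : realType) n (A : 'M[R]_n) :
  posdefmx A -> A \in unitmx.
Proof.
move=> [_ Apos]; rewrite -row_free_unit -kermx_eq0; apply/eqP/row_matrixP => i.
rewrite row0; apply/eqP/negPn/negP => v0.
have := Apos (row i (kermx A))^T; rewrite -[_ == 0](inj_eq trmx_inj) trmxK trmx0.
by move=> /(_ v0); rewrite -row_mul mulmx_ker row0 mul0mx mxE ltxx.
Qed.

Lemma dotmx_gt0 (R : realType) n (v : 'cV[R]_n) :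
  v != 0 -> 0 < (v^T *m v) 0 0.
Proof.
move=> v0; rewrite lt_def; apply/andP; split; last first.
  by rewrite mxE sumr_ge0// => i _; rewrite mxE -expr2 sqr_ge0.
apply: contra v0 => /eqP; rewrite mxE => /eqP.
rewrite psumr_eq0; last by move=> i _; rewrite mxE -expr2 sqr_ge0.
move=> /allP v0; apply/eqP/matrixP => i j; rewrite ord1 !mxE.
by have := v0 i (mem_index_enum _); rewrite mxE -expr2 sqrf_eq0 => /eqP.
Qed.

Lemma posdefmx_eigenvalue (R : realType) n (A : 'M[R]_n) (a : R) :
  posdefmx A -> eigenvalue A a -> 0 < a.
Proof.
move=> [_ Apos] /eigenvalueP[v vA v0].
have v0' : v^T != 0 by rewrite -[_ == 0](inj_eq trmx_inj) trmxK trmx0.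
have := Apos _ v0'; rewrite trmxK vA -scalemxAl mxE.
by rewrite pmulr_lgt0//; have := dotmx_gt0 v0'; rewrite trmxK.
Qed.

Lemma trmx_horner (R : comNzRingType) n (A : 'M[R]_n.+1) (p : {poly R}) :
  (horner_mx A p)^T = horner_mx A^T p.
Proof.
elim/poly_ind: p => [|p c IHp]; first by rewrite !rmorph0 trmx0.
rewrite !rmorphD !rmorphM /= !horner_mx_C !horner_mx_X linearD /= tr_scalar_mx.
congr (_ + _); rewrite -[in LHS]mulmxE trmx_mul IHp.
exact/esym/comm_horner_mx/comm_mx_refl.
Qed.

Lemma posdefmx_annihilated (R : realType) n (A : 'M[R]_n.+1) :
  posdefmx A -> exists s : seq R, [/\ uniq s, {in s, forall a, 0 < a} &
    forall p : {poly R}, {in s, forall a, p.[a] = 0} -> horner_mx A p = 0].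
Proof.
move=> Apd.
pose toC : {rmorphism R -> R[i]} := real_complex R.
have AC : map_mx toC A \is hermsymmx.
  apply: realsym_hermsym.
    apply/is_hermitianmxP; rewrite expr0 scale1r map_mx_id//.
    by rewrite map_trmx Apd.1.
  by apply/mxOverP => i j; rewrite mxE complex_real.
have /hermitian_normalmx/orthomx_spectralP := AC.
set P := spectralmx _; set sp := spectral_diag _ => ACE.
have Pu : P \in unitmx by exact: spectral_unit.
have /mxOverP spR := hermitian_spectral_diag_real AC.
exists (undup [seq complex.Re (sp ord0 j) | j <- enum 'I_n.+1]); split.
- exact: undup_uniq.
- move=> a; rewrite mem_undup => /mapP[j _ ->].
  apply: (posdefmx_eigenvalue Apd).
  rewrite eigenvalue_root_char -(fmorph_root toC) map_char_poly.
  rewrite -eigenvalue_root_char [toC _]RRe_real//; apply/eigenvalueP.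
  exists (row j P).
    by rewrite -row_mul ACE -!mulmxA mulKVmx// row_mul row_diag_mx -scalemxAl -rowE.
  apply/eqP => Pj0; have : row j (P *m invmx P) = 0 by rewrite row_mul Pj0 mul0mx.
  rewrite mulmxV// => /rowP/(_ j)/eqP.
  by rewrite !mxE eqxx oner_eq0.
move=> p pA; apply: (map_mx_inj (f := toC)); rewrite map_mx0 map_horner_mx ACE.
rewrite horner_mx_uconjC// horner_mx_diag.
have -> : map_mx (horner (map_poly toC p)) sp = 0.
  apply/matrixP => i j; rewrite ord1 !mxE {i}.
  rewrite -(RRe_real (spR ord0 j)) [LHS](horner_map toC) pA ?rmorph0//.
  by rewrite mem_undup; apply/mapP; exists j; rewrite ?mem_enum.
by rewrite linear0 mulmx0 mul0mx.
Qed.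

Lemma posdefmx_sqrt (R : realType) n (A : 'M[R]_n.+1) :
  posdefmx A -> exists B, posdefmx B /\ B *m B = A.
Proof.
move=> Apd.
have [s [us s0 sA]] := posdefmx_annihilated Apd.
have [r rE] := interpolation (fun a => Num.sqrt (Num.sqrt a)) us.
pose B := horner_mx A r.
have BT : B^T = B by rewrite /B trmx_horner Apd.1.
have B4 : (B *m B) *m (B *m B) = A.
  rewrite !mulmxE /B -!rmorphM /=; apply/eqP; rewrite -subr_eq0.
  rewrite -[X in _ - X]horner_mx_X -rmorphB /=; apply/eqP/sA => a sa.
  have a0 := s0 a sa.
  have sqE x : 0 <= x -> Num.sqrt x * Num.sqrt x = x :> R.
    by move=> x0; rewrite -expr2 sqr_sqrtr.
  rewrite !(hornerD, hornerN, hornerM, hornerX) rE//.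
  by rewrite !sqE ?sqrtr_ge0 ?(ltW a0)// subrr.
exists (B *m B); split => //; split; first by rewrite trmx_mul BT.
move=> v v0; rewrite mulmxA -mulmxA -{1}BT -trmx_mul.
apply: dotmx_gt0; apply: contra v0 => /eqP Bv0.
have : A *m v = 0 by rewrite -B4 -!mulmxA Bv0 !mulmx0.
by move/(congr1 (mulmx (invmx A))); rewrite mulKmx ?posdefmx_unitmx// mulmx0 => ->.
Qed.

Lemma sqrtmxP (R : realType) n (A : 'M[R]_n.+1) :
  posdefmx A -> posdefmx (sqrtmx A) /\ sqrtmx A *m sqrtmx A = A.
Proof.
move=> /posdefmx_sqrt[B BA]; rewrite /sqrtmx.
by case: xgetP => [C _ //|/(_ B)]; case.
Qed.

Lemma posdefmx_det_gt0 (R : realType) n (A : 'M[R]_n.+1) :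
  posdefmx A -> 0 < \det A.
Proof.
move=> Apd; have [B [Bpd <-]] := posdefmx_sqrt Apd.
rewrite det_mulmx -expr2 lt_def sqr_ge0 andbT sqrf_eq0 -unitfE -unitmxE.
exact: posdefmx_unitmx.
Qed.

(** * Polynomial functions and directional derivatives on matrices *)

Section polyfun.
Context (R : realType) (d m : nat).
Notation M := 'M[R]_(d, m).

Inductive polyfun : (M -> R) -> Prop :=
| polyfun_cst c : polyfun (fun=> c)
| polyfun_coord i j : polyfun (fun X => X i j)
| polyfunD f g : polyfun f -> polyfun g -> polyfun (fun X => f X + g X)
| polyfunM f g : polyfun f -> polyfun g -> polyfun (fun X => f X * g X).

Definition polymx p q (A : M -> 'M[R]_(p, q)) :=
  forall i j, polyfun (fun X => A X i j).

Lemma eq_polyfun f g : f =1 g -> polyfun f -> polyfun g.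
Proof. by move=> /funext ->. Qed.

Lemma polyfunN f : polyfun f -> polyfun (fun X => - f X).
Proof.
move=> pf; apply: (@eq_polyfun (fun X => -1 * f X)).
  by move=> X; rewrite mulN1r.
by apply: polyfunM => //; exact: polyfun_cst.
Qed.

Lemma polyfunB f g : polyfun f -> polyfun g -> polyfun (fun X => f X - g X).
Proof. by move=> pf pg; apply: polyfunD => //; exact: polyfunN. Qed.

Lemma polyfun_sum I (r : seq I) (P : pred I) (f : I -> M -> R) :
  (forall i, polyfun (f i)) -> polyfun (fun X => \sum_(i <- r | P i) f i X).
Proof.
move=> pf; elim: r => [|x r IHr].
  by apply: eq_polyfun (polyfun_cst 0) => X; rewrite big_nil.
case Px : (P x); last by apply: eq_polyfun IHr => X; rewrite big_cons Px.
by apply: eq_polyfun (polyfunD (pf x) IHr) => X; rewrite big_cons Px.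
Qed.

Lemma polyfun_prod I (r : seq I) (P : pred I) (f : I -> M -> R) :
  (forall i, polyfun (f i)) -> polyfun (fun X => \prod_(i <- r | P i) f i X).
Proof.
move=> pf; elim: r => [|x r IHr].
  by apply: eq_polyfun (polyfun_cst 1) => X; rewrite big_nil.
case Px : (P x); last by apply: eq_polyfun IHr => X; rewrite big_cons Px.
by apply: eq_polyfun (polyfunM (pf x) IHr) => X; rewrite big_cons Px.
Qed.

Lemma polymx_id : polymx id.
Proof. by move=> i j; exact: polyfun_coord. Qed.

Lemma polymx_cst p q (A : 'M[R]_(p, q)) : polymx (fun=> A).
Proof. by move=> i j; exact: polyfun_cst. Qed.

Lemma polymxD p q (A B : M -> 'M[R]_(p, q)) :
  polymx A -> polymx B -> polymx (fun X => A X + B X).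
Proof.
move=> pA pB i j; apply: eq_polyfun (polyfunD (pA i j) (pB i j)) => X.
by rewrite mxE.
Qed.

Lemma polymxZ p q (a : M -> R) (A : M -> 'M[R]_(p, q)) :
  polyfun a -> polymx A -> polymx (fun X => a X *: A X).
Proof.
move=> pa pA i j; apply: eq_polyfun (polyfunM pa (pA i j)) => X.
by rewrite mxE.
Qed.

Lemma polymxM p q r (A : M -> 'M[R]_(p, q)) (B : M -> 'M[R]_(q, r)) :
  polymx A -> polymx B -> polymx (fun X => A X *m B X).
Proof.
move=> pA pB i j; apply: (@eq_polyfun (fun X => \sum_k A X i k * B X k j)).
  by move=> X; rewrite mxE.
by apply: polyfun_sum => k; exact: polyfunM.
Qed.

Lemma polymx_tr p q (A : M -> 'M[R]_(p, q)) :
  polymx A -> polymx (fun X => (A X)^T).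
Proof. by move=> pA i j; apply: eq_polyfun (pA j i) => X; rewrite mxE. Qed.

Lemma polyfun_tr n (A : M -> 'M[R]_n) :
  polymx A -> polyfun (fun X => \tr (A X)).
Proof. by move=> pA; apply: polyfun_sum. Qed.

Lemma polyfun_det n (A : M -> 'M[R]_n) :
  polymx A -> polyfun (fun X => \det (A X)).
Proof.
move=> pA; apply: polyfun_sum => s; apply: polyfunM; first exact: polyfun_cst.
exact: polyfun_prod.
Qed.

Lemma polymx_adj n (A : M -> 'M[R]_n) :
  polymx A -> polymx (fun X => \adj (A X)).
Proof.
move=> pA i j; apply: (@eq_polyfun (fun X => cofactor (A X) j i)).
  by move=> X; rewrite mxE.
apply: polyfunM; first exact: polyfun_cst.
apply: polyfun_det => k l; apply: eq_polyfun (pA (lift j k) (lift i l)) => X.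
by rewrite !mxE.
Qed.

Lemma measurable_polyfun f : polyfun f -> measurable_fun [set: M] f.
Proof.
elim=> [c|i j|{}f g _ mf _ mg|{}f g _ mf _ mg].
- exact: measurable_cst.
- exact: measurable_mx_coord.
- exact: measurable_funD.
- exact: measurable_funM.
Qed.

Lemma continuous_polyfun_line f (X H : M) :
  polyfun f -> continuous (fun s : R => f (X + s *: H)).
Proof.
elim=> [c|i j|{}f g _ cf _ cg|{}f g _ cf _ cg] s.
- exact: cvg_cst.
- rewrite (_ : (fun _ => _) = fun s : R => X i j + s * H i j); last first.
    by apply/funext => t; rewrite !mxE.
  apply: cvgD; first exact: cvg_cst.
  by apply: cvgM; [exact: cvg_id|exact: cvg_cst].
- exact: cvgD (cf s) (cg s).
- exact: cvgM (cf s) (cg s).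
Qed.

Definition sqnorm (X : M) : R := \tr (X *m X^T).

Lemma sqnormE (X : M) : sqnorm X = \sum_i \sum_j X i j ^+ 2.
Proof.
apply: eq_bigr => i _; rewrite mxE; apply: eq_bigr => j _.
by rewrite mxE expr2.
Qed.

Lemma sqnorm_ge0 (X : M) : 0 <= sqnorm X.
Proof.
by rewrite sqnormE sumr_ge0// => i _; rewrite sumr_ge0// => j _; rewrite sqr_ge0.
Qed.

Lemma sqr_coord_le (X : M) i j : X i j ^+ 2 <= sqnorm X.
Proof.
rewrite sqnormE (bigD1 i)//= (bigD1 j)//= -addrA lerDl addr_ge0//.
  by rewrite sumr_ge0// => k _; rewrite sqr_ge0.
by rewrite sumr_ge0// => k _; rewrite sumr_ge0// => l _; rewrite sqr_ge0.
Qed.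

Lemma norm_coord_le (X : M) i j : `|X i j| <= 1 + sqnorm X.
Proof.
have := sqr_coord_le X i j; rewrite -real_normK ?num_real//.
have := normr_ge0 (X i j); set x := `|_|; set t := sqnorm X.
by have := sqnorm_ge0 X; rewrite -/t => *; nra.
Qed.

Lemma polyfun_growth f : polyfun f ->
  exists (C : R) k, 0 <= C /\ forall X, `|f X| <= C * (1 + sqnorm X) ^+ k.
Proof.
have t1 X k l : (k <= l)%N -> (1 + sqnorm X) ^+ k <= (1 + sqnorm X) ^+ l.
  by move=> kl; apply: ler_weXn2l => //; rewrite lerDl sqnorm_ge0.
have t0 X k : 0 <= (1 + sqnorm X) ^+ k by rewrite exprn_ge0// addr_ge0// sqnorm_ge0.
elim=> [c|i j|{}f g _ [A [k [A0 fA]]] _ [B [l [B0 gB]]]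
             |{}f g _ [A [k [A0 fA]]] _ [B [l [B0 gB]]]].
- by exists `|c|, 0%N; split => // X; rewrite expr0 mulr1.
- exists 1, 1%N; split => // X; rewrite mul1r expr1; exact: norm_coord_le.
- exists (A + B), (maxn k l); split; first exact: addr_ge0.
  move=> X; apply: (le_trans (ler_normD _ _)); rewrite mulrDl lerD//.
    by apply: (le_trans (fA X)); rewrite ler_wpM2l// t1// leq_maxl.
  by apply: (le_trans (gB X)); rewrite ler_wpM2l// t1// leq_maxr.
- exists (A * B), (k + l)%N; split; first exact: mulr_ge0.
  by move=> X; rewrite normrM exprD mulrACA ler_pM.
Qed.

Lemma polyfun_damped f delta : polyfun f -> 0 < delta ->
  exists B : R, forall X, `|f X| * expR (- (delta * sqnorm X)) <= B.
Proof.
move=> /polyfun_growth[C [k [C0 fC]]] d0.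
pose c := Num.min 1 (delta / k.+1%:R).
have c0 : 0 < c by rewrite lt_min ltr01 divr_gt0.
exists (C * c ^- k.+1) => X.
set t := sqnorm X; have t0 : 0 <= t := sqnorm_ge0 X.
have h : (c * (1 + t)) ^+ k.+1 <= expR (delta * t).
  rewrite [delta * t](_ : _ = (delta / k.+1%:R * t) * k.+1%:R); last first.
    by rewrite mulrAC divfK.
  rewrite expRM_natr lerXn2r ?nnegrE ?expR_ge0 ?mulr_ge0 ?addr_ge0// ?(ltW c0)//.
  apply: le_trans (expR_ge1Dx _); rewrite mulrDr mulr1 lerD//.
    by rewrite ge_min lexx.
  by rewrite ler_wpM2r// ge_min lexx orbT.
rewrite expRN ler_pdivrMr ?expR_gt0//.
apply: (le_trans (fC X)); rewrite -mulrA ler_wpM2l// -/t.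
rewrite mulrC ler_pdivlMr ?exprn_gt0//; apply: le_trans h.
rewrite exprMn mulrC ler_wpM2l ?exprn_ge0 ?(ltW c0)//.
by apply: ler_weXn2l => //; rewrite lerDl.
Qed.

End polyfun.

Section directional.
Context (R : realType) (d m : nat) (H : 'M[R]_(d, m)).
Notation M := 'M[R]_(d, m).

Definition hasD (f f' : M -> R) := forall X,
  is_derive (0 : R) 1 (fun s : R => f (X + s *: H)) (f' X).

Definition hasDmx p q (A A' : M -> 'M[R]_(p, q)) :=
  forall i j, hasD (fun X => A X i j) (fun X => A' X i j).

Let at0 (f : M -> R) X : f (X + (0 : R) *: H) = f X.
Proof. by rewrite scale0r addr0. Qed.

Lemma eq_hasD f f' g' : f' =1 g' -> hasD f f' -> hasD f g'.
Proof. by move=> /funext ->. Qed.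

Lemma hasD_cst c : hasD (fun=> c) (fun=> 0).
Proof. by move=> X; exact: is_derive_cst. Qed.

Lemma hasD_coord i j : hasD (fun X => X i j) (fun=> H i j).
Proof.
move=> X; rewrite (_ : (fun _ => _) = fun s : R => X i j + s * H i j); last first.
  by apply/funext => t; rewrite !mxE.
have h := is_deriveD (is_derive_cst (X i j) (0 : R) 1)
  (is_deriveM (is_derive_id (0 : R) 1) (is_derive_cst (H i j) (0 : R) 1)).
by apply: (is_derive_eq h); rewrite /= scale0r !add0r [_ *: _]mulr1.
Qed.

Lemma hasD_add f f' g g' : hasD f f' -> hasD g g' ->
  hasD (fun X => f X + g X) (fun X => f' X + g' X).
Proof. by move=> hf hg X; exact: is_deriveD. Qed.

Lemma hasD_mul f f' g g' : hasD f f' -> hasD g g' ->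
  hasD (fun X => f X * g X) (fun X => f' X * g X + f X * g' X).
Proof.
move=> hf hg X; have := is_deriveM (hf X) (hg X).
by rewrite !at0 addrC [_ *: f' X]mulrC.
Qed.

Lemma hasD_sum I (r : seq I) (f f' : I -> M -> R) :
  (forall i, hasD (f i) (f' i)) ->
  hasD (fun X => \sum_(i <- r) f i X) (fun X => \sum_(i <- r) f' i X).
Proof.
move=> hf; elim: r => [|x r IHr].
  rewrite (_ : (fun X => _) = fun=> 0); last by apply/funext => X; rewrite big_nil.
  by apply: eq_hasD (hasD_cst 0) => X; rewrite big_nil.
rewrite (_ : (fun X => _) = fun X => f x X + \sum_(i <- r) f i X); last first.
  by apply/funext => X; rewrite big_cons.
by apply: eq_hasD (hasD_add (hf x) IHr) => X; rewrite big_cons.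
Qed.

Lemma hasD_prod (I : eqType) (r : seq I) (f f' : I -> M -> R) : uniq r ->
  (forall i, hasD (f i) (f' i)) ->
  hasD (fun X => \prod_(i <- r) f i X)
    (fun X => \sum_(k <- r) f' k X * \prod_(i <- r | i != k) f i X).
Proof.
move=> + hf; elim: r => [_|x r IHr /= /andP[xr /IHr{}IHr]].
  rewrite (_ : (fun X => _) = fun=> 1); last by apply/funext => X; rewrite big_nil.
  by apply: eq_hasD (hasD_cst 1) => X; rewrite big_nil.
rewrite (_ : (fun X => _) = fun X => f x X * \prod_(i <- r) f i X); last first.
  by apply/funext => X; rewrite big_cons.
apply: eq_hasD (hasD_mul (hf x) IHr) => X; rewrite big_cons; congr (_ * _ + _).
  rewrite big_cons eqxx /= [RHS]big_seq_cond [LHS]big_seq.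
  apply: eq_bigl => i; case: (boolP (i \in r)) => //= ir; apply/esym.
  by apply: contraNneq xr => <-.
rewrite big_distrr /= big_seq [RHS]big_seq; apply: eq_bigr => k kr.
rewrite big_cons ifT; first by rewrite mulrCA.
by apply: contraNneq xr => ->.
Qed.

Lemma hasDmx_id : hasDmx id (fun=> H).
Proof. by move=> i j; exact: hasD_coord. Qed.

Lemma hasDmx_cst p q (A : 'M[R]_(p, q)) : hasDmx (fun=> A) (fun=> 0).
Proof. by move=> i j; apply: eq_hasD (hasD_cst _) => X; rewrite mxE. Qed.

Lemma hasDmx_add p q (A A' B B' : M -> 'M[R]_(p, q)) :
  hasDmx A A' -> hasDmx B B' ->
  hasDmx (fun X => A X + B X) (fun X => A' X + B' X).
Proof.
move=> hA hB i j; rewrite (_ : (fun X => _) = fun X => A X i j + B X i j); last first.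
  by apply/funext => X; rewrite mxE.
by apply: eq_hasD (hasD_add (hA i j) (hB i j)) => X; rewrite mxE.
Qed.

Lemma hasDmx_scale p q (a a' : M -> R) (A A' : M -> 'M[R]_(p, q)) :
  hasD a a' -> hasDmx A A' ->
  hasDmx (fun X => a X *: A X) (fun X => a' X *: A X + a X *: A' X).
Proof.
move=> ha hA i j; rewrite (_ : (fun X => _) = fun X => a X * A X i j); last first.
  by apply/funext => X; rewrite mxE.
by apply: eq_hasD (hasD_mul ha (hA i j)) => X; rewrite !mxE.
Qed.

Lemma hasDmx_mul p q r (A A' : M -> 'M[R]_(p, q)) (B B' : M -> 'M[R]_(q, r)) :
  hasDmx A A' -> hasDmx B B' ->
  hasDmx (fun X => A X *m B X) (fun X => A' X *m B X + A X *m B' X).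
Proof.
move=> hA hB i j.
rewrite (_ : (fun X => _) = fun X => \sum_k A X i k * B X k j); last first.
  by apply/funext => X; rewrite mxE.
apply: eq_hasD (hasD_sum _ (fun k => hasD_mul (hA i k) (hB k j))) => X.
by rewrite big_split /= !mxE.
Qed.

Lemma hasDmx_tr p q (A A' : M -> 'M[R]_(p, q)) :
  hasDmx A A' -> hasDmx (fun X => (A X)^T) (fun X => (A' X)^T).
Proof.
move=> hA i j; rewrite (_ : (fun X => _) = fun X => A X j i); last first.
  by apply/funext => X; rewrite mxE.
by apply: eq_hasD (hA j i) => X; rewrite mxE.
Qed.

Lemma hasD_trace n (A A' : M -> 'M[R]_n) :
  hasDmx A A' -> hasD (fun X => \tr (A X)) (fun X => \tr (A' X)).
Proof. by move=> hA; exact: (hasD_sum _ (fun i => hA i i)). Qed.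

Lemma hasD_det n (A A' : M -> 'M[R]_n) :
  hasDmx A A' -> hasD (fun X => \det (A X)) (fun X => \tr (A' X *m \adj (A X))).
Proof.
move=> hA.
have hP (s : 'S_n) := hasD_prod (index_enum_uniq 'I_n) (fun i => hA i (s i)).
have := hasD_sum (index_enum _)
  (fun s : {perm 'I_n} => hasD_mul (hasD_cst ((-1) ^+ s)) (hP s)).
apply: eq_hasD => X.
pose B k := \matrix_(i, j) (if i == k then A' X k j else A X i j).
transitivity (\sum_k \det (B k)); last first.
  apply: eq_bigr => k _; rewrite (expand_det_row _ k) mxE.
  apply: eq_bigr => j _; rewrite !mxE eqxx; congr (_ * (_ * \det _)).
  by apply/matrixP => i l; rewrite !mxE eq_sym (negbTE (neq_lift _ _)).
rewrite exchange_big /=; apply: eq_bigr => s _; rewrite mul0r add0r big_distrr /=.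
apply: eq_bigr => k _; congr (_ * _); rewrite [RHS](bigD1 k)//= mxE eqxx.
by congr (_ * _); apply: eq_bigr => i /negbTE ik; rewrite mxE ik.
Qed.

Lemma hasD_expR f f' : hasD f f' ->
  hasD (fun X => expR (f X)) (fun X => expR (f X) * f' X).
Proof.
move=> hf X.
have h : is_derive (f (X + (0 : R) *: H)) 1 expR (expR (f X)).
  by rewrite at0; exact: is_derive_expR.
exact: (is_derive1_comp h (hf X)).
Qed.

Lemma hasD_powR f f' a : hasD f f' -> (forall X, 0 < f X) ->
  hasD (fun X => f X `^ a) (fun X => f X `^ a * (a * (f' X / f X))).
Proof.
move=> hf f0.
have hln : hasD (fun X => ln (f X)) (fun X => f' X / f X).
  move=> X; have h : is_derive (f (X + (0 : R) *: H)) 1 (@ln R) (f X)^-1.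
    by rewrite at0; exact: is_derive1_ln.
  by have := is_derive1_comp h (hf X); rewrite mulrC.
have := hasD_expR (hasD_mul (hasD_cst a) hln).
rewrite (_ : (fun X => expR _) = fun X => f X `^ a); last first.
  by apply/funext => X; rewrite /powR gt_eqF.
by apply: eq_hasD => X; rewrite mul0r add0r /powR gt_eqF.
Qed.

Lemma hasD_line f f' : hasD f f' -> forall X (s : R),
  is_derive s 1 (fun s : R => f (X + s *: H)) (f' (X + s *: H)).
Proof.
move=> hf X s.
have dg : is_derive (s - s) 1
    (fun t : R => f (X + s *: H + t *: H)) (f' (X + s *: H)).
  by rewrite subrr.
rewrite -[f' _]mulr1.
rewrite (_ : (fun _ => _) =
    (fun t : R => f (X + s *: H + t *: H)) \o (fun t => t - s)).
  by apply: is_derive1_comp; exact: is_derive_shift.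
by apply/funext => t /=; rewrite -addrA -scalerDl [s + _]addrC subrK.
Qed.

Lemma hasD_continuous f f' : hasD f f' -> forall X,
  continuous (fun s : R => f (X + s *: H)).
Proof.
move=> hf X s; apply/differentiable_continuous/derivable1_diffP.
by case: (hasD_line hf X s).
Qed.

End directional.

Section ibp.
Context (R : realType) (d m : nat).
Variable mu : {sigma_finite_measure set 'M[R]_(d, m) -> \bar R}.
Hypothesis mu_shift : forall (H : 'M[R]_(d, m)) (A : set 'M[R]_(d, m)),
  measurable A -> mu ((fun X => X + H) @^-1` A) = mu A.
Local Open Scope ereal_scope.

Lemma measurable_mx_shift (H : 'M[R]_(d, m)) :
  measurable_fun setT (fun X : 'M[R]_(d, m) => (X + H)%R).
Proof.
apply: measurable_fun_mx => i j.
rewrite (_ : (fun x => _) = fun X : 'M[R]_(d, m) => (X i j + H i j)%R).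
  by apply: measurable_realfun.measurable_funD => //; exact: measurable_mx_coord.
by apply/funext => X; rewrite mxE.
Qed.

Lemma ge0_integral_mx_shift (H : 'M[R]_(d, m)) (f : 'M[R]_(d, m) -> \bar R) :
  measurable_fun setT f -> (forall X, 0 <= f X) ->
  \int[mu]_X f (X + H)%R = \int[mu]_X f X.
Proof.
move=> mf f0; have mH := measurable_mx_shift H.
rewrite -[LHS](ge0_integral_pushforward mH mu (D := setT))//.
by apply: eq_measure_integral => //= A mA _; exact: mu_shift.
Qed.

Lemma integral_mx_shift (H : 'M[R]_(d, m)) (f : 'M[R]_(d, m) -> \bar R) :
  measurable_fun setT f ->
  \int[mu]_X f (X + H)%R = \int[mu]_X f X.
Proof.
move=> mf; rewrite integralE [RHS]integralE; congr (_ - _).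
  rewrite -(ge0_integral_mx_shift H (measurable_funepos mf))//.
  by apply: eq_integral => X _; rewrite !unlock.
rewrite -(ge0_integral_mx_shift H (measurable_funeneg mf))//.
by apply: eq_integral => X _; rewrite !unlock.
Qed.

Lemma integral_directional_derivative (H : 'M[R]_(d, m))
    (F F' : 'M[R]_(d, m) -> R) :
  mu.-integrable setT (EFin \o F) -> mu.-integrable setT (EFin \o F') ->
  hasD H F F' ->
  (forall X, continuous (fun s : R => F' (X + s *: H)%R)) ->
  \int[mu]_X (F' X)%:E = 0.
Proof.
move=> iF iF' dF cF'.
have dFs := hasD_line dF.
have cF := hasD_continuous dF.
have ftc X : \int[lebesgue_measure]_(s in `[0%R, 1%R]) (F' (X + s *: H)%R)%:E =
    (F (X + H)%R)%:E - (F X)%:E.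
  rewrite (@continuous_FTC2 _ _ (fun s : R => F (X + s *: H)%R))//.
  - by rewrite scale1r scale0r addr0.
  - exact: continuous_subspaceT.
  - by split => [s _| |]; [case: (dFs X s)|
      exact/cvg_at_right_filter/cF|exact/cvg_at_left_filter/cF].
  - by move=> s _; rewrite derive1E; apply: derive_val.
have mF : measurable_fun setT (EFin \o F) by case/integrableP: iF.
have mF' : measurable_fun setT (EFin \o F') by case/integrableP: iF'.
have iFH : mu.-integrable setT (fun X => (F (X + H)%R)%:E).
  apply/integrableP; split.
    apply: (measurableT_comp mF); exact: measurable_mx_shift.
  rewrite (ge0_integral_mx_shift H (f := fun X => `|(F X)%:E|))//.
    by case/integrableP: iF.
  exact: measurableT_comp.
have : \int[mu]_X ((F (X + H)%R)%:E - (F X)%:E) = 0.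
  rewrite integralB// (integral_mx_shift H mF) subee//.
  exact: integrable_fin_num.
under eq_integral do rewrite -ftc.
pose D : set (measurableTypeR R) := `[0%R, 1%R]%classic.
pose g (p : 'M[R]_(d, m) * measurableTypeR R) :=
  ((F' (p.1 + p.2 *: H) * \1_D p.2)%R)%:E.
have mD : measurable D by exact: measurable_itv.
have lD : lebesgue_measure D = 1%:E.
  by rewrite /D lebesgue_measure_itv/= lte01 oppr0 adde0.
have mXs : measurable_fun setT
    (fun p : 'M[R]_(d, m) * measurableTypeR R => (p.1 + p.2 *: H)%R).
  apply: measurable_fun_mx => i j.
  rewrite (_ : (fun p => _) = fun p : 'M[R]_(d, m) * measurableTypeR R =>
      (p.1 i j + p.2 * H i j)%R); last by apply/funext => p; rewrite !mxE.
  apply: measurable_realfun.measurable_funD.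
    by apply: (measurableT_comp (@measurable_mx_coord R d m i j)).
  by apply: measurable_realfun.measurable_funM => //.
have mg : measurable_fun setT g.
  apply/measurable_EFinP/measurable_realfun.measurable_funM.
    apply: (measurableT_comp _ mXs); exact/measurable_EFinP.
  by apply: measurableT_comp => //.
have gE X s : g (X, s) = ((fun s => (F' (X + s *: H)%R)%:E) \_ D) s.
  rewrite /g patchE /= indicE; case: ifP => _; first by rewrite mulr1.
  by rewrite mulr0.
have gX s : \int[mu]_X `|g (X, s)| = (\int[mu]_X `|(F' X)%:E|) * (\1_D s)%:E.
  rewrite -(ge0_integral_mx_shift (s *: H)%R (f := fun X => `|(F' X)%:E|))//;
    last exact: measurableT_comp.
  rewrite -ge0_integralZr//.
  - apply: eq_integral => X _; rewrite /g /= -EFinM normrM indicE.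
    by case: (_ \in _); rewrite /= ?normr0 ?normr1.
  - have := measurableT_comp mF' (measurable_mx_shift (s *: H)).
    by apply: measurableT_comp.
have ig : (mu \x lebesgue_measure).-integrable setT g.
  apply/integrable21ltyP => //; under eq_integral do rewrite gX.
  rewrite ge0_integralZl//.
  - rewrite integral_indic// setIT [X in _ * X < _]lD mule1.
    by case/integrableP: iF'.
  - by apply: measurableT_comp => //; exact: measurable_indic.
  - exact: integral_ge0.
have -> : \int[mu]_X \int[lebesgue_measure]_(s in `[0%R, 1%R])
    (F' (X + s *: H)%R)%:E = \int[lebesgue_measure]_s \int[mu]_X g (X, s).
  rewrite -(Fubini ig); apply: eq_integral => X _; rewrite [LHS]integral_mkcond.
  by apply: eq_integral => s _; rewrite gE.
move=> <-; apply/esym.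
transitivity (\int[lebesgue_measure]_(s in D) \int[mu]_X (F' X)%:E).
  rewrite [RHS]integral_mkcond; apply: eq_integral => s _.
  rewrite patchE -(integral_mx_shift (s *: H)%R mF'); case: ifPn => [Ds|Ds].
    by apply: eq_integral => X _; rewrite gE patchE Ds.
  by rewrite integral0_eq// => X _; rewrite gE patchE (negbTE Ds).
rewrite integral_cst// [X in _ * X]lD mule1.
by [].
Qed.
End ibp.

Section algebra.
Context (R : realType) (d m : nat).
Notation M := 'M[R]_(d, m).

Lemma mul_delta_mxE p q (A : 'M[R]_(p, d)) (B : 'M[R]_(m, q)) i j k l :
  (A *m delta_mx i j *m B) k l = A k i * B j l.
Proof.
rewrite -(mul_delta_mx (0 : 'I_1)) mulmxA -colE -mulmxA -rowE mxE big_ord1.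
by rewrite !mxE.
Qed.

Lemma frob_delta_mx (i : 'I_d) (j : 'I_m) (A : 'M[R]_(m, d)) :
  \tr (delta_mx i j *m A) = A j i.
Proof.
rewrite -[delta_mx i j]mul1mx /mxtrace.
under eq_bigr do rewrite mul_delta_mxE.
rewrite (bigD1 i)//= !mxE eqxx mul1r big1 ?addr0// => k ki.
by rewrite mxE (negbTE ki) mul0r.
Qed.

Lemma sqnorm_tr (X : M) : sqnorm X^T = sqnorm X.
Proof. by rewrite /sqnorm trmxK mxtrace_mulC. Qed.

Lemma polyfun_sqnorm : polyfun (@sqnorm R d m).
Proof.
apply: polyfun_tr.
by apply: polymxM; [exact: polymx_id|apply: polymx_tr; exact: polymx_id].
Qed.

Lemma hasD_sqnorm i j : hasD (delta_mx i j) (@sqnorm R d m) (fun X => 2 * X i j).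
Proof.
have h : hasD (delta_mx i j) (@sqnorm R d m)
    (fun X => \tr (delta_mx i j *m X^T + X *m (delta_mx i j)^T)).
  apply: hasD_trace; apply: hasDmx_mul; first exact: hasDmx_id.
  apply: hasDmx_tr; exact: hasDmx_id.
apply: eq_hasD h => X; rewrite linearD /= frob_delta_mx.
rewrite -[X in _ + X]mxtrace_tr trmx_mul !trmxK frob_delta_mx mxE.
by rewrite mulr2n mulrDl mul1r.
Qed.

End algebra.

(** * Integration by parts against the density *)

Section tmatrix.
Context (R : realType) (d' m : nat).
Notation d := d'.+1.
Notation M := 'M[R]_(d, m).
Variables (nu : R) (nu_gt0 : 0 < nu).

Definition Wmx (X : M) : 'M[R]_d := 1%:M + nu^-1 *: (X *m X^T).

Lemma tr_Wmx X : (Wmx X)^T = Wmx X.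
Proof. by rewrite /Wmx linearD /= trmx1 linearZ /= trmx_mul trmxK. Qed.

Lemma Wmx_det_gt0 X : 0 < \det (Wmx X).
Proof.
apply: posdefmx_det_gt0; split; first exact: tr_Wmx.
move=> v v0; rewrite /Wmx mulmxDr mulmx1 mulmxDl mxE ltr_wpDr ?dotmx_gt0//.
rewrite -scalemxAr -scalemxAl mxE mulr_ge0 ?invr_ge0 ?(ltW nu_gt0)//.
rewrite mulmxA -[v^T *m X *m X^T *m v]mulmxA -[X in _ *m (X *m v)]trmxK.
have -> : v^T *m X *m (X^T^T^T *m v) = v^T *m X *m (v^T *m X)^T.
  by rewrite trmx_mul !trmxK.
by rewrite mxE sumr_ge0// => i _; rewrite [in X in _ * X]mxE -expr2 sqr_ge0.
Qed.

Definition Qmx (X : M) : M := (\det (Wmx X))^-1 *: (\adj (Wmx X) *m X).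

Lemma mul_Wmx_Qmx X : Wmx X *m Qmx X = X.
Proof.
rewrite /Qmx -scalemxAr mulmxA mul_mx_adj mul_scalar_mx scalerA mulVf ?scale1r//.
by rewrite gt_eqF// Wmx_det_gt0.
Qed.

Lemma sqnorm_Qmx X : sqnorm (Qmx X) <= sqnorm X.
Proof.
set q := Qmx X.
have h0 : 0 <= sqnorm (X - q) by exact: sqnorm_ge0.
have hX : \tr (X *m q^T) = sqnorm q + nu^-1 * sqnorm (X^T *m q).
  rewrite -{1}(mul_Wmx_Qmx X) -/q /Wmx mulmxDl mul1mx mulmxDl linearD /=.
  congr (_ + _); rewrite -!scalemxAl linearZ /=; congr (_ * _).
  rewrite [LHS]mxtrace_mulC -sqnorm_tr /sqnorm trmxK trmx_mul trmxK.
  by rewrite !mulmxA.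
have hqX : \tr (q *m X^T) = \tr (X *m q^T).
  by rewrite -mxtrace_tr trmx_mul trmxK.
have h1 : 0 <= nu^-1 * sqnorm (X^T *m q).
  by rewrite mulr_ge0 ?sqnorm_ge0// invr_ge0 ltW.
move: h0; rewrite /sqnorm linearB /= mulmxBl !mulmxBr !linearB /= -!/(sqnorm _).
by rewrite hqX hX; lra.
Qed.

Lemma norm_Qmx_le X i j : `|Qmx X i j| <= 1 + sqnorm X.
Proof. by apply: le_trans (norm_coord_le _ _ _) _; rewrite lerD2l sqnorm_Qmx. Qed.

Lemma polymx_Wmx : polymx Wmx.
Proof.
apply: polymxD; first exact: polymx_cst.
apply: polymxZ; first exact: polyfun_cst.
by apply: polymxM; [exact: polymx_id|apply: polymx_tr; exact: polymx_id].
Qed.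

Lemma hasD_det_Wmx i j : hasD (delta_mx i j) (fun X => \det (Wmx X))
  (fun X => 2 / nu * (\adj (Wmx X) *m X) i j).
Proof.
have hW : hasDmx (delta_mx i j) Wmx (fun X => 0 + (0 *: (X *m X^T) +
    nu^-1 *: (delta_mx i j *m X^T + X *m (delta_mx i j)^T))).
  apply: hasDmx_add; first exact: hasDmx_cst.
  apply: hasDmx_scale; first exact: hasD_cst.
  by apply: hasDmx_mul; [exact: hasDmx_id|apply: hasDmx_tr; exact: hasDmx_id].
apply: eq_hasD (hasD_det hW) => X.
have adjT : (\adj (Wmx X))^T = \adj (Wmx X) by rewrite trmx_adj tr_Wmx.
rewrite add0r scale0r add0r -scalemxAl linearZ /= mulmxDl linearD /=.
rewrite -mulmxA frob_delta_mx -[\tr (X *m _ *m _)]mxtrace_tr !trmx_mul trmxK adjT.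
rewrite mxtrace_mulC -mulmxA frob_delta_mx.
have -> : (X^T *m \adj (Wmx X)) j i = (\adj (Wmx X) *m X) i j.
  by rewrite -{1}adjT -trmx_mul mxE.
by field; rewrite gt_eqF.
Qed.

End tmatrix.

Section divergence.
Context (R : realType) (d m : nat).
Notation M := 'M[R]_(d, m).

Lemma sum_mul_delta_mx (A : 'M[R]_d) (B : 'M[R]_m) :
  \sum_i \sum_j (A *m delta_mx i j *m B) i j = \tr A * \tr B.
Proof.
rewrite big_distrl; apply: eq_bigr => i _; rewrite big_distrr.
by apply: eq_bigr => j _; rewrite mul_delta_mxE.
Qed.

Lemma sum_mul_delta_mx_tr (A B : M) :
  \sum_i \sum_j (A *m (delta_mx i j)^T *m B) i j = \tr (A *m B^T).
Proof.
apply: eq_bigr => i _; rewrite mxE; apply: eq_bigr => j _.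
by rewrite trmx_delta mul_delta_mxE mxE.
Qed.

Definition has_div (G : M -> M) (D : M -> R) := polymx G /\
  exists2 G' : 'I_d -> 'I_m -> M -> M,
    forall i j, hasDmx (delta_mx i j) G (G' i j) /\ polymx (G' i j) &
    forall X, D X = \sum_i \sum_j G' i j X i j.

Lemma has_divD G1 G2 D1 D2 : has_div G1 D1 -> has_div G2 D2 ->
  has_div (fun X => G1 X + G2 X) (fun X => D1 X + D2 X).
Proof.
move=> [p1 [G1' h1 D1E]] [p2 [G2' h2 D2E]]; split; first exact: polymxD.
exists (fun i j X => G1' i j X + G2' i j X) => [i j|X].
  have [? ?] := h1 i j; have [? ?] := h2 i j.
  by split; [exact: hasDmx_add|exact: polymxD].
rewrite D1E D2E -big_split; apply: eq_bigr => i _; rewrite -big_split.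
by apply: eq_bigr => j _; rewrite mxE.
Qed.

Lemma has_divZ (c : R) G D : has_div G D ->
  has_div (fun X => c *: G X) (fun X => c * D X).
Proof.
move=> [p1 [G' h1 DE]]; split; first by apply: polymxZ => //; exact: polyfun_cst.
exists (fun i j X => 0 *: G X + c *: G' i j X) => [i j|X].
  have [? ?] := h1 i j; split.
    by apply: hasDmx_scale => //; exact: hasD_cst.
  by apply: polymxD; apply: polymxZ => //; exact: polyfun_cst.
rewrite DE big_distrr; apply: eq_bigr => i _; rewrite big_distrr.
by apply: eq_bigr => j _; rewrite scale0r add0r mxE.
Qed.

Lemma has_div_sqnorm G D : has_div G D ->
  has_div (fun X => sqnorm X *: G X)
    (fun X => sqnorm X * D X + 2 * \tr (G X *m X^T)).
Proof.
move=> [p1 [G' h1 DE]].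
split; first by apply: polymxZ => //; exact: polyfun_sqnorm.
exists (fun i j (X : M) => (2 * X i j) *: G X + sqnorm X *: G' i j X) => [i j|X].
  have [? ?] := h1 i j; split.
    by apply: hasDmx_scale => //; exact: hasD_sqnorm.
  apply: polymxD; apply: polymxZ => //; last exact: polyfun_sqnorm.
  by apply: polyfunM; [exact: polyfun_cst|exact: polyfun_coord].
rewrite DE addrC !big_distrr -big_split; apply: eq_bigr => i _ /=.
rewrite !mxE !big_distrr -big_split; apply: eq_bigr => j _ /=.
by rewrite !mxE; ring.
Qed.

Definition gram (X : M) : 'M[R]_d := X *m X^T.

Lemma polymx_gram : polymx gram.
Proof. by apply: polymxM; [exact: polymx_id|apply/polymx_tr/polymx_id]. Qed.

Lemma hasDmx_gram H : hasDmx H gram (fun X => H *m X^T + X *m H^T).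
Proof.
by apply: hasDmx_mul; [exact: hasDmx_id|apply: hasDmx_tr; exact: hasDmx_id].
Qed.

Ltac polymx_tac := do ?[exact: polymx_id | exact: polymx_gram |
  exact: polymx_cst | apply: polymx_tr | apply: polymxD | apply: polymxM].
Ltac hasDmx_tac := do ?[exact: hasDmx_id | exact: hasDmx_gram |
  apply: hasDmx_mul].

Lemma has_div_id : has_div id (fun=> m%:R * d%:R).
Proof.
split; first exact: polymx_id.
exists (fun i j _ => delta_mx i j) => [i j|X].
  by split; [exact: hasDmx_id|exact: polymx_cst].
transitivity (\sum_(i < d) \sum_(j < m) (1 : R)).
  by rewrite sumr_const card_ord sumr_const card_ord mulr_natr.
by apply: eq_bigr => i _; apply: eq_bigr => j _; rewrite mxE !eqxx.
Qed.

Lemma has_div_gram : has_div (fun X => gram X *m X)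
  (fun X => (m%:R + d%:R + 1) * sqnorm X).
Proof.
split; first by polymx_tac.
exists (fun i j X => (delta_mx i j *m X^T + X *m (delta_mx i j)^T) *m X +
   gram X *m delta_mx i j) => [i j|X].
  by split; [hasDmx_tac|polymx_tac].
transitivity (\sum_i \sum_j (((1%:M *m delta_mx i j *m (X^T *m X)) i j +
    (X *m (delta_mx i j)^T *m X) i j) +
    (gram X *m delta_mx i j *m 1%:M) i j)); last first.
  apply: eq_bigr => i _; apply: eq_bigr => j _.
  by rewrite mul1mx mulmx1 mulmxDl mulmxA !mxE.
under [RHS]eq_bigr do rewrite !big_split /=.
rewrite !big_split /= !sum_mul_delta_mx sum_mul_delta_mx_tr !mxtrace1.
by rewrite mxtrace_mulC -/(sqnorm X); ring.
Qed.

Lemma has_div_gram2 : has_div (fun X => gram X *m (gram X *m X))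
  (fun X => (m%:R + d%:R + 2) * \tr (gram X *m gram X) + sqnorm X ^+ 2).
Proof.
split; first by polymx_tac.
pose E i j : M := delta_mx i j.
exists (fun i j X => (E i j *m X^T + X *m (E i j)^T) *m (gram X *m X) +
   gram X *m ((E i j *m X^T + X *m (E i j)^T) *m X + gram X *m E i j))
  => [i j|X].
  by split; [hasDmx_tac|polymx_tac].
transitivity (\sum_i \sum_j ((((1%:M *m delta_mx i j *m (X^T *m (gram X *m X))) i j +
    (X *m (delta_mx i j)^T *m (gram X *m X)) i j) +
    (gram X *m delta_mx i j *m (X^T *m X)) i j) +
    ((gram X *m X) *m (delta_mx i j)^T *m X) i j +
    (gram X *m gram X *m delta_mx i j *m 1%:M) i j)); last first.
  apply: eq_bigr => i _; apply: eq_bigr => j _.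
  by rewrite /E mul1mx mulmx1 !(mulmxDr, mulmxDl) !mulmxA !mxE !addrA.
under [RHS]eq_bigr do rewrite !big_split /=.
rewrite !big_split /= !sum_mul_delta_mx !sum_mul_delta_mx_tr !mxtrace1.
have -> : \tr (X^T *m (gram X *m X)) = \tr (gram X *m gram X).
  by rewrite mxtrace_mulC -mulmxA -/(gram X).
have -> : \tr (X *m (gram X *m X)^T) = \tr (gram X *m gram X).
  rewrite trmx_mul [(gram X)^T]trmx_mul trmxK.
  by rewrite -/(gram X) mulmxA.
have -> : \tr (gram X *m X *m X^T) = \tr (gram X *m gram X).
  by rewrite -mulmxA -/(gram X).
have -> : \tr (X^T *m X) = sqnorm X by rewrite mxtrace_mulC.
by rewrite -/(sqnorm X); ring.
Qed.

End divergence.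

Section density.
Context dd (T : measurableType dd) (R : realType).
Variables (mu : {sigma_finite_measure set T -> \bar R}) (Q : probability T R).
Variable (p : T -> R).
Hypotheses (mp : measurable_fun setT p) (p0 : forall x, 0 <= p x).
Hypothesis QE : forall A, measurable A -> Q A = (\int[mu]_(x in A) (p x)%:E)%E.
Local Open Scope ereal_scope.

Lemma integrable_density : mu.-integrable setT (EFin \o p).
Proof.
apply/integrableP; split; first exact/measurable_EFinP.
under eq_integral do rewrite /= ger0_norm//.
by rewrite -QE// probability_setT ltry.
Qed.

Lemma integral_density (h : T -> R) : Q.-integrable setT (EFin \o h) ->
  \int[Q]_x (h x)%:E = \int[mu]_x (h x * p x)%:E.
Proof.
move=> ih.
have Qmu : Q `<< mu.
  apply/null_content_dominatesP => A mA muA0.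
  by rewrite QE// null_set_integral//; exact/measurable_EFinP/measurable_funTS.
have := @Radon_Nikodym_change_of_variables _ _ _ Q mu Qmu _ _ measurableT ih.
move=> <-; apply: ae_eq_integral => //.
- apply: emeasurable_funM; first by case/integrableP: ih.
  by apply: measurable_int; exact: Radon_Nikodym_integrable.
- apply/measurable_EFinP/measurable_funM => //.
  by apply/measurable_EFinP; case/integrableP: ih.
have : ae_eq mu setT (Radon_Nikodym (charge_of_finite_measure Q) mu) (EFin \o p).
  apply: integral_ae_eq => //.
  - exact: Radon_Nikodym_integrable.
  - exact/measurable_EFinP.
  - move=> E _ mE; rewrite -Radon_Nikodym_integral//=.
    exact: QE.
by apply: filterS => x /(_ Logic.I) /= -> _; rewrite EFinM.
Qed.

End density.

Section damping.
Context (R : realType) dd (T : measurableType dd) (Q : probability T R).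
Variables (tau u v e : T -> R) (C : R).
Hypotheses (mtau : measurable_fun setT tau) (mu : measurable_fun setT u)
  (mv : measurable_fun setT v) (me : measurable_fun setT e).
Hypotheses (tau0 : forall x, 0 <= tau x) (u0 : forall x, 0 <= u x)
  (v0 : forall x, 0 <= v x) (e0 : forall x, 0 <= e x).
Hypothesis iu : Q.-integrable setT (EFin \o u).
Hypothesis eC : forall x, e x <= C * (1 + tau x) * (1 + v x).
Let f (delta : R) x := expR (- (delta * tau x)) * (u x - v x - 2 * delta * e x).
Hypothesis if_ : forall delta, 0 < delta -> Q.-integrable setT (EFin \o f delta).
Hypothesis f0 : forall delta, 0 < delta -> (\int[Q]_x (f delta x)%:E = 0)%E.

Let psi (n : nat) x := expR (- (n.+1%:R^-1 * tau x)).

Let psi_le1 n x : psi n x <= 1.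
Proof. by rewrite -expR0 ler_expR oppr_le0 mulr_ge0. Qed.

Let psi_ge0 n x : 0 <= psi n x. Proof. exact: expR_ge0. Qed.

Let mpsi n : measurable_fun setT (psi n).
Proof.
apply: measurableT_comp => //; apply: measurable_funN.
exact: measurable_funM.
Qed.

Let cvg_harm : (fun n => n.+1%:R^-1 : R) @ \oo --> (0 : R).
Proof. exact: cvg_harmonic. Qed.

Let psi_cvg x : psi ^~ x @ \oo --> (1 : R).
Proof.
rewrite -expR0; apply: continuous_cvg; first exact: continuous_expR.
rewrite -oppr0; apply: cvgN; rewrite -(mul0r (tau x)).
by apply: cvgM => //; exact: cvg_cst.
Qed.

Let C0 x : 0 <= C * (1 + v x).
Proof.
have := le_trans (e0 x) (eC x).
rewrite mulrAC pmulr_lge0// ltr_pwDl//.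
Qed.

Lemma damped_integrable : Q.-integrable setT (EFin \o v).
Proof.
have pv n : (\int[Q]_x (psi n x * v x)%:E <= \int[Q]_x (u x)%:E)%E.
  have d0 : 0 < n.+1%:R^-1 :> R by rewrite invr_gt0.
  have ipu : Q.-integrable setT (fun x => (psi n x * u x)%:E).
    apply: le_integrable iu => //.
      by apply/measurable_EFinP/measurable_funM.
    move=> x _ /=; rewrite lee_fin normrM ler_piMl//.
    by rewrite ger0_norm.
  apply: (@le_trans _ _ (\int[Q]_x ((psi n x * u x)%:E - (f n.+1%:R^-1 x)%:E))%E).
    apply: ge0_le_integral => //.
    - by move=> x _; rewrite lee_fin mulr_ge0.
    - by apply/measurable_EFinP/measurable_funM.
    - apply: emeasurable_funB; first by case/integrableP: ipu.
      by case/integrableP: (if_ d0).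
    - move=> x _; rewrite -EFinB lee_fin -subr_ge0.
      rewrite [leRHS](_ : _ = psi n x * (2 * n.+1%:R^-1 * e x)); last first.
        by rewrite /f /psi; ring.
      by rewrite !mulr_ge0// ltW.
  rewrite integralB//; last exact: if_.
  rewrite f0// sube0; apply: ge0_le_integral => //.
  - by move=> x _; rewrite lee_fin mulr_ge0.
  - by case/integrableP: ipu.
  - by case/integrableP: iu.
  - by move=> x _; rewrite lee_fin ler_piMl.
apply/integrableP; split; first exact/measurable_EFinP.
have -> : (\int[Q]_x `|(EFin \o v) x| = \int[Q]_x limn (fun n => (psi n x * v x)%:E))%E.
  apply: eq_integral => x _; apply/esym/cvg_lim => //=.
  rewrite ger0_norm//; apply: cvg_EFin; first exact: nearW.
  rewrite -[X in _ --> X]mul1r; apply: cvgM; [exact: psi_cvg|exact: cvg_cst].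
rewrite monotone_convergence//.
- apply: (@le_lt_trans _ _ (\int[Q]_x (u x)%:E)%E); last first.
    by case/integrableP: iu => _; under eq_integral do rewrite /= ger0_norm//.
  apply: lime_le; last exact: nearW.
  apply: ereal_nondecreasing_is_cvgn => n p np; apply: ge0_le_integral => //.
  + by move=> x _; rewrite lee_fin mulr_ge0.
  + by apply/measurable_EFinP/measurable_funM.
  + by apply/measurable_EFinP/measurable_funM.
  + move=> x _; rewrite lee_fin ler_wpM2r// ler_expR lerN2 ler_wpM2r//.
    by rewrite lef_pV2 ?posrE// ler_nat.
- by move=> n; apply/measurable_EFinP/measurable_funM.
- by move=> n x _; rewrite lee_fin mulr_ge0.
- move=> x _ n p np; rewrite lee_fin ler_wpM2r// ler_expR lerN2 ler_wpM2r//.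
  by rewrite lef_pV2 ?posrE// ler_nat.
Qed.

Lemma damped_integral : (\int[Q]_x (v x)%:E = \int[Q]_x (u x)%:E)%E.
Proof.
have iv := damped_integrable.
pose g x := (u x + v x + 4 * (C * (1 + v x))).
have ig : Q.-integrable setT (EFin \o g).
  rewrite (_ : EFin \o g = fun x =>
      ((u x)%:E + (v x)%:E + (4 * C)%:E * (1%:E + (v x)%:E))%E).
    apply: integrableD => //; first exact: integrableD.
    apply: integrableZl => //; apply: integrableD => //.
    exact: finite_measure_integrable_cst.
  by apply/funext => x /=; congr EFin; rewrite /g mulrA.
have mf delta : measurable_fun setT (f delta).
  apply: measurable_funM.
    apply: measurableT_comp => //; apply: measurable_funN.
    exact: measurable_funM.
  apply: measurable_funB; first exact: measurable_funB.
  by apply: measurable_funM.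
have [||||_ _] := @dominated_convergence _ _ R Q setT measurableT
  (fun n => EFin \o f n.+1%:R^-1) (fun x => (u x - v x)%:E) (EFin \o g) _ _ _ ig _.
- by move=> n; apply/measurable_EFinP.
- by apply/measurable_EFinP/measurable_funB.
- apply: aeW => x _; apply: cvg_EFin; first exact: nearW.
  rewrite -[X in _ --> X]mul1r; apply: cvgM; first exact: psi_cvg.
  rewrite -[X in _ --> X]subr0; apply: cvgB; first exact: cvg_cst.
  rewrite -(mul0r (e x)); apply: cvgM; last exact: cvg_cst.
  rewrite -(mulr0 2); apply: cvgM => //; exact: cvg_cst.
- apply: aeW => x n _; rewrite /= lee_fin /f /g -/(psi n x).
  set s := n.+1%:R^-1; set t := tau x.
  have s0 : 0 <= s by rewrite invr_ge0.
  have s1 : s <= 1 by rewrite invf_le1// ler1n.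
  have p1 : s * t * psi n x <= 1.
    rewrite /psi expRN -/s -/t ler_pdivrMr ?expR_gt0// mul1r.
    by apply: le_trans (expR_ge1Dx _); rewrite -/t lerDr ler01.
  have := psi_le1 n x; have := psi_ge0 n x; have := u0 x; have := v0 x.
  have := C0 x; have := eC x; have := e0 x; have : 0 <= t := tau0 x.
  rewrite -/t; set K := psi n x in p1 *.
  rewrite (_ : C * (1 + t) * (1 + v x) = (1 + t) * (C * (1 + v x))); last by ring.
  move: (u x) (v x) (e x) => a b w; move: (C * (1 + b)) => c t0 w0 wc c0 b0 a0 K0 K1.
  have h1 : `|K * (a - b - 2 * s * w)| <= K * (a + b) + K * (2 * s * w).
    have sw0 : 0 <= s * w by rewrite mulr_ge0.
    rewrite normrM (ger0_norm K0) -mulrDr ler_wpM2l// ler_norml.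
    by apply/andP; split; lra.
  apply: (le_trans h1); apply: lerD; first by rewrite ler_piMl// addr_ge0.
  apply: (@le_trans _ _ (2 * (K * s * (1 + t)) * c)).
    have : 0 <= K * s * ((1 + t) * c - w).
      apply: mulr_ge0; first by rewrite mulr_ge0.
      by rewrite subr_ge0.
    by lra.
  rewrite ler_wpM2r//.
  have : K * s <= 1 by rewrite mulr_ile1.
  by lra.
move=> h.
have /cvg_lim : (fun n => \int[Q]_x (f n.+1%:R^-1 x)%:E)%E @ \oo -->
    (\int[Q]_x (u x - v x)%:E)%E by exact: h.
rewrite (_ : (fun n => _) = cst 0%E); last by apply/funext => n; exact: f0.
rewrite lim_cst// => /(_ (@ereal_hausdorff R))/esym.
under eq_integral do rewrite EFinB.
rewrite integralB// => /eqP; rewrite sube_eq ?add0e//.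
- by move/eqP => ->.
- exact: integrable_fin_num.
Qed.

End damping.

Section tibp.
Context (R : realType) (d' m : nat).
Notation d := d'.+1.
Notation M := 'M[R]_(d, m).
Variables (nu a c : R) (nu_gt0 : 0 < nu).
Variable mu : {sigma_finite_measure set M -> \bar R}.
Hypothesis mu_shift : forall (H : M) (A : set M),
  measurable A -> mu ((fun X => X + H) @^-1` A) = mu A.
Variable Q : probability M R.
Hypothesis c_ge0 : 0 <= c.
Hypothesis Q_density : forall A : set M, measurable A ->
  Q A = (\int[mu]_(X in A) (c * \det (Wmx nu X) `^ (- a))%:E)%E.

Let p (X : M) := c * \det (Wmx nu X) `^ (- a).

Let QE A : measurable A -> Q A = (\int[mu]_(X in A) (p X)%:E)%E.
Proof. exact: Q_density. Qed.

Let w0 (X : M) : 0 < \det (Wmx nu X).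
Proof. exact: Wmx_det_gt0. Qed.

Let p0 (X : M) : 0 <= p X.
Proof. by rewrite mulr_ge0// powR_ge0. Qed.

Let mp : measurable_fun [set: M] p.
Proof.
apply: measurable_funM => //; apply: (measurableT_comp (measurable_powR _)).
by apply: measurable_polyfun; apply: polyfun_det; exact: polymx_Wmx.
Qed.

Let ip : mu.-integrable setT (EFin \o p).
Proof. exact: integrable_density mp p0 QE. Qed.

Let psi delta (X : M) : R := expR (- (delta * sqnorm X)).

Let mpsi delta : measurable_fun [set: M] (psi delta).
Proof.
apply: measurableT_comp => //; apply: measurable_funN; apply: measurable_funM => //.
by apply: measurable_polyfun; exact: polyfun_sqnorm.
Qed.

Let mQmx i j : measurable_fun [set: M] (fun X => Qmx nu X i j).
Proof.
rewrite (_ : (fun X => _) = fun X => (\adj (Wmx nu X) *m X) i j *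
    \det (Wmx nu X) `^ (- 1)); last first.
  by apply/funext => X; rewrite mxE mulrC powR_inv1// ltW.
apply: measurable_funM.
  apply: measurable_polyfun; apply: polymxM; last exact: polymx_id.
  by apply: polymx_adj; exact: polymx_Wmx.
apply: (measurableT_comp (measurable_powR _)).
by apply: measurable_polyfun; apply: polyfun_det; exact: polymx_Wmx.
Qed.

(* [- (2 * a / nu) * Qmx] is the logarithmic gradient of the density [p]. *)
Let term delta (g g' : M -> R) i j (X : M) :=
  psi delta X * (g' X - 2 * delta * (X i j * g X) -
    2 * a / nu * (g X * Qmx nu X i j)).

Let termE delta g g' i j X : term delta g g' i j X =
  (g' X - 2 * delta * (X i j * g X)) * psi delta X -
  ((2 * a / nu * g X) * psi delta X) * Qmx nu X i j.
Proof. by rewrite /term; ring. Qed.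

Let term_bounded delta g g' i j : 0 < delta -> polyfun g -> polyfun g' ->
  exists B : R, forall X, `|term delta g g' i j X| <= B.
Proof.
move=> d0 pg pg'.
have pX : polyfun (fun X : M => X i j) by exact: polyfun_coord.
have [|B1 h1] := @polyfun_damped _ _ _
  (fun X => g' X - 2 * delta * (X i j * g X)) _ _ d0.
  apply: polyfunB => //; apply: polyfunM; first exact: polyfun_cst.
  exact: polyfunM.
have [|B2 h2] := @polyfun_damped _ _ _
  (fun X => (2 * a / nu * g X) * (1 + sqnorm X)) _ _ d0.
  apply: polyfunM; first by apply: polyfunM => //; exact: polyfun_cst.
  by apply: polyfunD; [exact: polyfun_cst|exact: polyfun_sqnorm].
exists (B1 + B2) => X; rewrite termE; apply: (le_trans (ler_normB _ _)).
have psi0 : 0 <= psi delta X by exact: expR_ge0.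
rewrite lerD//; first by apply: le_trans (h1 X); rewrite normrM (ger0_norm psi0).
apply: le_trans (h2 X); rewrite !normrM (ger0_norm psi0).
rewrite (ger0_norm (_ : 0 <= 1 + sqnorm X)) ?addr_ge0 ?sqnorm_ge0//.
rewrite [leRHS]mulrAC ler_wpM2l ?norm_Qmx_le//.
by rewrite !mulr_ge0.
Qed.

Let measurable_term delta g g' i j : polyfun g -> polyfun g' ->
  measurable_fun [set: M] (term delta g g' i j).
Proof.
move=> pg pg'; rewrite (_ : term _ _ _ _ _ = fun X =>
  (g' X - 2 * delta * (X i j * g X)) * psi delta X -
  ((2 * a / nu * g X) * psi delta X) * Qmx nu X i j); last first.
  by apply/funext => X; exact: termE.
have pX : polyfun (fun X : M => X i j) by exact: polyfun_coord.
apply: measurable_funB; apply: measurable_funM => //.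
  apply: measurable_polyfun; apply: polyfunB => //; apply: polyfunM.
    exact: polyfun_cst.
  exact: polyfunM.
apply: measurable_funM => //; apply: measurable_polyfun.
by apply: polyfunM => //; exact: polyfun_cst.
Qed.

Let bounded_integrable (h : M -> R) : measurable_fun [set: M] h ->
  (exists B : R, forall X, `|h X| <= B) -> mu.-integrable setT (fun X => (h X * p X)%:E).
Proof.
move=> mh [B hB]; apply: (@le_integrable _ _ _ mu setT measurableT _
    (fun X => B%:E * (p X)%:E)%E).
- by apply/measurable_EFinP/measurable_funM.
- move=> X _ /=; rewrite lee_fin [leLHS]normrM [leRHS]normrM.
  rewrite (ger0_norm (p0 X)) ler_wpM2r//.
  exact: le_trans (hB X) (ler_norm _).
- exact: integrableZl.
Qed.

Let bounded_Qintegrable (h : M -> R) : measurable_fun [set: M] h ->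
  (exists B : R, forall X, `|h X| <= B) -> Q.-integrable setT (EFin \o h).
Proof.
move=> mh [B hB]; apply: (@le_integrable _ _ _ Q setT measurableT _
    (cst B%:E)).
- exact/measurable_EFinP.
- move=> X _ /=; rewrite lee_fin.
  exact: le_trans (hB X) (ler_norm _).
- exact: finite_measure_integrable_cst.
Qed.

Let integral_term delta g g' i j : 0 < delta -> polyfun g -> polyfun g' ->
  hasD (delta_mx i j) g g' -> (\int[Q]_X (term delta g g' i j X)%:E = 0)%E.
Proof.
move=> d0 pg pg' hg.
rewrite (integral_density mp QE); last first.
  by apply: bounded_Qintegrable; [exact: measurable_term|exact: term_bounded].
have hpsi : hasD (delta_mx i j) (psi delta)
    (fun X => psi delta X * (- (delta * (2 * X i j)))).
  have := hasD_expR (hasD_mul (hasD_cst _ (- delta)) (hasD_sqnorm i j)).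
  rewrite (_ : (fun X => expR _) = psi delta); last first.
    by apply/funext => X; rewrite /psi mulNr.
  by apply: eq_hasD => X; rewrite /psi mul0r add0r !mulNr.
have hp : hasD (delta_mx i j) p
    (fun X => p X * (- (2 * a / nu * Qmx nu X i j))).
  have := hasD_mul (hasD_cst _ c)
    (hasD_powR (- a) (hasD_det_Wmx nu_gt0 i j) w0).
  apply: eq_hasD => X.
  have qE : Qmx nu X i j = (\det (Wmx nu X))^-1 * (\adj (Wmx nu X) *m X) i j.
    by rewrite mxE.
  rewrite mul0r add0r /p qE.
  by field; rewrite (gt_eqF nu_gt0) (gt_eqF (w0 X)).
have hF : hasD (delta_mx i j) (fun X => g X * psi delta X * p X)
    (fun X => term delta g g' i j X * p X).
  have := hasD_mul (hasD_mul hg hpsi) hp.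
  by apply: eq_hasD => X; rewrite /term; ring.
apply: (integral_directional_derivative mu_shift _ _ hF).
- apply: bounded_integrable.
    by apply: measurable_funM => //; exact: measurable_polyfun.
  have [B hB] := polyfun_damped pg d0; exists B => X.
  by rewrite normrM (ger0_norm (expR_ge0 _)).
- apply: bounded_integrable; first exact: measurable_term.
  exact: term_bounded.
- move=> X s.
  have cp f : polyfun f ->
      {for s, continuous (fun s : R => f (X + s *: delta_mx i j))}.
    by move=> pf; exact: continuous_polyfun_line.
  have cQ : {for s, continuous (fun s : R => Qmx nu (X + s *: delta_mx i j) i j)}.
    rewrite (_ : (fun s => _) = fun s : R =>
        (\det (Wmx nu (X + s *: delta_mx i j)))^-1 *
        (\adj (Wmx nu (X + s *: delta_mx i j)) *m (X + s *: delta_mx i j)) i j);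
      last by apply/funext => t; rewrite mxE.
    apply: continuousM.
      apply: continuousV; first by rewrite gt_eqF// w0.
      have h := cp (fun X => \det (Wmx nu X)) (polyfun_det (@polymx_Wmx R d' m nu)).
      exact: h.
    apply: (cp (fun X => (\adj (Wmx nu X) *m X) i j)); apply: polymxM;
      last exact: polymx_id.
    by apply: polymx_adj; exact: polymx_Wmx.
  have cpsi : {for s, continuous (fun s : R => psi delta (X + s *: delta_mx i j))}.
    exact: (hasD_continuous hpsi).
  have cpp : {for s, continuous (fun s : R => p (X + s *: delta_mx i j))}.
    exact: (hasD_continuous hp).
  have c1 := cp (fun X => g' X - 2 * delta * (X i j * g X))
    (polyfunB pg' (polyfunM (polyfun_cst _ _ (2 * delta))
      (polyfunM (polyfun_coord _ i j) pg))).
  have c2 := continuousM (cp _ (polyfun_cst _ _ (2 * a / nu))) (continuousM (cp _ pg) cQ).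
  exact: (continuousM (continuousM cpsi (continuousB c1 c2)) cpp).
Qed.

Let sum_lin3 (k k2 k3 : R) (x y z : 'I_d -> 'I_m -> R) :
  \sum_i \sum_j k * (x i j - k2 * y i j - k3 * z i j) =
  k * (\sum_i \sum_j x i j - k2 * \sum_i \sum_j y i j -
       k3 * \sum_i \sum_j z i j).
Proof.
under eq_bigr do rewrite -mulr_sumr !sumrB -!mulr_sumr.
by rewrite -mulr_sumr !sumrB -!mulr_sumr.
Qed.

Let frobE (A B : M) : \tr (A *m B^T) = \sum_i \sum_j A i j * B i j.
Proof.
by apply: eq_bigr => i _; rewrite mxE; apply: eq_bigr => j _; rewrite mxE.
Qed.

Lemma damped_divergence (K : M -> M) (D : M -> R) delta : 0 < delta ->
  has_div (fun X => Wmx nu X *m K X) D ->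
  let f := fun X : M => expR (- (delta * sqnorm X)) *
    (D X - 2 * delta * \tr (K X *m X^T *m Wmx nu X)
     - 2 * a / nu * \tr (K X *m X^T)) in
  Q.-integrable setT (EFin \o f) /\ (\int[Q]_X (f X)%:E = 0)%E.
Proof.
move=> d0 [pG [G' hG DE]] f.
pose t i j := term delta (fun X => (Wmx nu X *m K X) i j) (fun X => G' i j X i j) i j.
have fE : EFin \o f = fun X => (\sum_(i < d) \sum_(j < m) (t i j X)%:E)%E.
  apply/funext => X /=; under eq_bigr do rewrite sumEFin.
  rewrite sumEFin; congr EFin; rewrite /t /term sum_lin3 -DE -!frobE.
  congr (_ * (_ - _ * _ - _ * _)).
    by rewrite -[RHS]mxtrace_tr trmx_mul trmxK [LHS]mxtrace_mulC mulmxA.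
  have XT : X^T = (Qmx nu X)^T *m Wmx nu X.
    by rewrite -{1}(mul_Wmx_Qmx nu_gt0 X) trmx_mul tr_Wmx.
  by rewrite XT mulmxA [LHS]mxtrace_mulC mulmxA.
have it i j : Q.-integrable setT (EFin \o t i j).
  have [hD pG'] := hG i j.
  apply: bounded_Qintegrable; first exact: measurable_term.
  exact: term_bounded.
split.
  rewrite fE; apply: integrable_sum => // i _.
  by apply: integrable_sum => // j _; exact: it.
rewrite -[LHS]/(integral _ _ (EFin \o f)) fE integral_sum//; last first.
  by move=> i; apply: integrable_sum => // j _; exact: it.
rewrite big1// => i _; rewrite integral_sum//; last by move=> j; exact: it.
rewrite big1// => j _.
by have [hD pG'] := hG i j; apply: integral_term.
Qed.

End tibp.

(** * Moments of the whitened law *)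

Section norms.
Context (R : realType).

Lemma cauchy_schwarz_sum n (a b : 'I_n -> R) :
  (\sum_i a i * b i) ^+ 2 <= (\sum_i a i ^+ 2) * (\sum_i b i ^+ 2).
Proof.
have h : 0 <= \sum_i \sum_j (a i * b j - a j * b i) ^+ 2.
  by apply: sumr_ge0 => i _; apply: sumr_ge0 => j _; exact: sqr_ge0.
suff : \sum_i \sum_j (a i * b j - a j * b i) ^+ 2 =
    2 * ((\sum_i a i ^+ 2) * (\sum_i b i ^+ 2)) - 2 * (\sum_i a i * b i) ^+ 2.
  by move=> E; move: h; rewrite E; lra.
rewrite (expr2 (\sum_i _)) !big_distrlr /=.
transitivity (\sum_i \sum_j (a i ^+ 2 * b j ^+ 2 + a j ^+ 2 * b i ^+ 2 -
    2 * (a i * b i * (a j * b j)))).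
  by apply: eq_bigr => i _; apply: eq_bigr => j _; ring.
under [LHS]eq_bigr do rewrite sumrB big_split /=.
rewrite sumrB big_split /= [X in _ + X - _]exchange_big /=; congr (_ - _).
  by rewrite mulr2n mulrDl mul1r.
by rewrite mulr_sumr; apply: eq_bigr => i _; rewrite mulr_sumr.
Qed.

Lemma sqnorm_mul_le p q r (A : 'M[R]_(p, q)) (B : 'M[R]_(q, r)) :
  sqnorm (A *m B) <= sqnorm A * sqnorm B.
Proof.
rewrite !sqnormE [\sum_(i < q) _]exchange_big /= big_distrlr /=.
apply: ler_sum => i _; apply: ler_sum => j _; rewrite mxE.
exact: cauchy_schwarz_sum.
Qed.

Variables d m : nat.
Implicit Type X : 'M[R]_(d, m).

Lemma tr_gram X : (gram X)^T = gram X.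
Proof. by rewrite /gram trmx_mul trmxK. Qed.

Lemma sqnorm_gram X : sqnorm (gram X) = \tr (gram X *m gram X).
Proof. by rewrite /sqnorm tr_gram. Qed.

Lemma sqnorm_gram_le X : sqnorm (gram X) <= sqnorm X ^+ 2.
Proof. by rewrite expr2 -[X in _ * X]sqnorm_tr; exact: sqnorm_mul_le. Qed.

Lemma sqr_sqnorm_le X : sqnorm X ^+ 2 <= d%:R * sqnorm (gram X).
Proof.
have -> : sqnorm X = \sum_i 1 * gram X i i.
  by apply: eq_bigr => i _; rewrite mul1r.
apply: (le_trans (cauchy_schwarz_sum _ _)).
rewrite expr1n sumr_const card_ord ler_wpM2l// sqnormE.
apply: ler_sum => i _; rewrite (bigD1 i)//= lerDl.
by apply: sumr_ge0 => j _; exact: sqr_ge0.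
Qed.

Lemma tr_gram3 X : \tr (gram X *m gram X *m gram X) = sqnorm (gram X *m X).
Proof.
by rewrite /sqnorm trmx_mul tr_gram -mulmxA [LHS]mxtrace_mulC !mulmxA.
Qed.

End norms.

Section moments.
Context (R : realType) (d' m : nat).
Notation d := d'.+1.
Notation M := 'M[R]_(d, m).
Variables (nu c : R) (nu_gt2 : 2 < nu).
Variable mu : {sigma_finite_measure set M -> \bar R}.
Hypothesis mu_shift : forall (H : M) (A : set M),
  measurable A -> mu ((fun X => X + H) @^-1` A) = mu A.
Variable Q : probability M R.
Hypothesis c_ge0 : 0 <= c.
Hypothesis QE : forall A : set M, measurable A ->
  Q A = (\int[mu]_(X in A)
    (c * \det (Wmx nu X) `^ (- ((nu + m%:R + d%:R - 1) / 2)))%:E)%E.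

Let nu_gt0 : 0 < nu. Proof. by apply: lt_trans nu_gt2. Qed.
Let m0 : 0 <= m%:R :> R. Proof. by []. Qed.
Let d0 : 0 <= d%:R :> R. Proof. by []. Qed.

Let mtau : measurable_fun [set: M] (@sqnorm R d m).
Proof. by apply: measurable_polyfun; exact: polyfun_sqnorm. Qed.

Let poly_sigma : polyfun (fun X : M => sqnorm (gram X)).
Proof.
apply: polyfun_tr; apply: polymxM; first exact: polymx_gram.
by apply: polymx_tr; exact: polymx_gram.
Qed.

Let msigma : measurable_fun [set: M] (fun X : M => sqnorm (gram X)).
Proof. exact: measurable_polyfun. Qed.

Lemma first_moment : Q.-integrable setT (EFin \o @sqnorm R d m) /\
  (\int[Q]_X (sqnorm X)%:E = (m%:R * d%:R * nu / (nu - 2))%:E)%E.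
Proof.
pose k := (nu - 2) / nu.
have k0 : 0 < k by rewrite divr_gt0// subr_gt0.
have hdiv : has_div (fun X : M => Wmx nu X *m X)
    (fun X => m%:R * d%:R + nu^-1 * ((m%:R + d%:R + 1) * sqnorm X)).
  have := has_divD (has_div_id R d m) (has_divZ nu^-1 (has_div_gram R d m)).
  rewrite (_ : (fun X => _ + _) = (fun X : M => Wmx nu X *m X))//.
  by apply/funext => X; rewrite /Wmx mulmxDl mul1mx -scalemxAl.
pose u (X : M) : R := m%:R * d%:R.
pose v (X : M) := k * sqnorm X.
pose e (X : M) := \tr (X *m X^T *m Wmx nu X).
have eE X : e X = sqnorm X + nu^-1 * sqnorm (gram X).
  by rewrite /e /Wmx mulmxDr mulmx1 linearD /= -scalemxAr linearZ /= sqnorm_gram.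
have hf delta : 0 < delta ->
    let f := fun X => expR (- (delta * sqnorm X)) * (u X - v X - 2 * delta * e X) in
    Q.-integrable setT (EFin \o f) /\ (\int[Q]_X (f X)%:E = 0)%E.
  move=> delta0 f.
  have := damped_divergence nu_gt0 mu_shift c_ge0 QE delta0 hdiv.
  rewrite (_ : (fun X => _) = f)//; apply/funext => X.
  rewrite /f; congr (_ * _); rewrite /u /v /k -/(e X) -/(sqnorm X).
  by field; rewrite gt_eqF.
have mu_ : measurable_fun [set: M] u by exact: measurable_cst.
have mv : measurable_fun [set: M] v by exact: measurable_funM.
have me : measurable_fun setT e.
  rewrite (_ : e = fun X => sqnorm X + nu^-1 * sqnorm (gram X)).
    by apply: measurable_funD => //; exact: measurable_funM.
  by apply/funext => X; exact: eE.
have tau0 := @sqnorm_ge0 R d m.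
have u0 X : 0 <= u X by rewrite mulr_ge0.
have v0 X : 0 <= v X by rewrite mulr_ge0// ltW.
have e0 X : 0 <= e X by rewrite eE addr_ge0// mulr_ge0 ?sqnorm_ge0// invr_ge0 ltW.
have iu : Q.-integrable setT (EFin \o u) by exact: finite_measure_integrable_cst.
have eC X : e X <= (1 + (nu * k)^-1) * (1 + sqnorm X) * (1 + v X).
  rewrite eE /v; set t := sqnorm X; have t0 : 0 <= t := tau0 X.
  have s1 : nu^-1 * sqnorm (gram X) <= nu^-1 * t ^+ 2.
    by rewrite ler_wpM2l ?invr_ge0 ?(ltW nu_gt0)// sqnorm_gram_le.
  apply: (le_trans (lerD (lexx t) s1)).
  rewrite (_ : nu^-1 * t ^+ 2 = (nu * k)^-1 * (t * (k * t))); last first.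
    by field; rewrite !gt_eqF.
  have : 0 <= (nu * k)^-1 by rewrite invr_ge0 mulr_ge0// ltW.
  have : 0 <= k * t by rewrite mulr_ge0// ltW.
  move: (k * t) (nu * k)^-1 => a b a0 b0.
  have ta : 0 <= t * a by rewrite mulr_ge0.
  have bt : 0 <= b * t by rewrite mulr_ge0.
  have ba : 0 <= b * a by rewrite mulr_ge0.
  have : (1 + b) * (1 + t) * (1 + a) =
    t + b * (t * a) + (1 + a + t * a + b + b * t + b * a) by ring.
  by move=> ->; rewrite lerDl !addr_ge0.
have iv := damped_integrable mtau mu_ mv tau0 u0 v0 e0 iu
  (fun delta d0 => (hf delta d0).1) (fun delta d0 => (hf delta d0).2).
have Ev := damped_integral mtau mu_ mv me tau0 u0 v0 e0 iu eC
  (fun delta d0 => (hf delta d0).1) (fun delta d0 => (hf delta d0).2).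
have tauE (X : M) : (sqnorm X)%:E = (k^-1%:E * (v X)%:E)%E.
  by rewrite -EFinM mulKf ?gt_eqF.
split.
  rewrite (_ : _ \o _ = fun X => (k^-1%:E * (v X)%:E)%E); last first.
    by apply/funext => X; exact: tauE.
  exact: integrableZl.
under eq_integral do rewrite tauE.
have Eu : (\int[Q]_X (u X)%:E = (m%:R * d%:R)%:E)%E.
  rewrite -[LHS]/(\int[Q]_(X in setT) cst (m%:R * d%:R)%:E X)%E.
  by rewrite integral_cst// [X in (_ * X)%E](probability_setT Q) mule1.
rewrite integralZl// Ev Eu -EFinM.
by congr EFin; rewrite /k; field; rewrite !gt_eqF// subr_gt0.
Qed.

Lemma second_moment : 4 < nu ->
  (\int[Q]_X (sqnorm (gram X))%:E = (m%:R * d%:R * nu ^+ 2 *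
    ((m%:R + d%:R) * (nu - 2) + nu + m%:R * d%:R) /
    ((nu - 1) * (nu - 2) * (nu - 4)))%:E)%E.
Proof.
move=> nu_gt4.
have [itau Etau] := first_moment.
have nu1 : 0 < nu - 1 by rewrite subr_gt0; lra.
have nu2 : 0 < nu - 2 by rewrite subr_gt0; lra.
have nu4 : 0 < nu - 4 by rewrite subr_gt0; lra.
pose k := (nu - 1) * (nu - 4) / nu.
have k0 : 0 < k by rewrite divr_gt0// mulr_gt0.
pose b : R := (m%:R + d%:R + 1) * (nu - 2) + m%:R * d%:R + 2.
have b0 : 0 <= b.
  have h1 : 0 <= (m%:R + d%:R + 1) * (nu - 2).
    by apply: mulr_ge0; [rewrite !addr_ge0|exact: ltW].
  have h2 : 0 <= m%:R * d%:R :> R by exact: mulr_ge0.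
  by rewrite /b; lra.
pose K (X : M) := (nu - 2) *: (gram X *m X) + sqnorm X *: X.
have hdiv := has_divD
  (has_divD (has_divZ (nu - 2) (has_div_gram R d m))
            (has_div_sqnorm (has_div_id R d m)))
  (has_divZ nu^-1 (has_divD (has_divZ (nu - 2) (has_div_gram2 R d m))
                            (has_div_sqnorm (has_div_gram R d m)))).
rewrite (_ : (fun X => _ + _) = (fun X : M => Wmx nu X *m K X)) in hdiv; last first.
  apply/funext => X; rewrite /Wmx mulmxDl mul1mx -scalemxAl; congr (_ + _ *: _).
  by rewrite /K mulmxDr -!scalemxAr.
pose u (X : M) : R := b * sqnorm X.
pose v (X : M) := k * sqnorm (gram X).
pose e (X : M) := \tr (K X *m X^T *m Wmx nu X).
have KX X : K X *m X^T = (nu - 2) *: (gram X *m gram X) + sqnorm X *: gram X.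
  by rewrite /K mulmxDl -!scalemxAl -mulmxA.
have eE X : e X = (nu - 2) * (sqnorm (gram X) + nu^-1 * sqnorm (gram X *m X))
    + sqnorm X * (sqnorm X + nu^-1 * sqnorm (gram X)).
  rewrite /e KX /Wmx mulmxDr mulmx1 -scalemxAr mulmxDl -!scalemxAl.
  rewrite !(mxtraceD, mxtraceZ).
  by rewrite tr_gram3 -sqnorm_gram -[\tr (gram X)]/(sqnorm X); ring.
have hf delta : 0 < delta ->
    let f := fun X => expR (- (delta * sqnorm X)) * (u X - v X - 2 * delta * e X) in
    Q.-integrable setT (EFin \o f) /\ (\int[Q]_X (f X)%:E = 0)%E.
  move=> delta0 f.
  have := damped_divergence nu_gt0 mu_shift c_ge0 QE delta0 hdiv.
  rewrite (_ : (fun X => _) = f)//; apply/funext => X.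
  rewrite /f; congr (_ * _); rewrite /u /v /k /b -/(e X) KX.
  rewrite !(mxtraceD, mxtraceZ) -mulmxA -[X *m X^T]/(gram X) -!sqnorm_gram.
  rewrite -[\tr (gram X)]/(sqnorm X).
  by field; rewrite gt_eqF.
have mu_ : measurable_fun setT u by exact: measurable_funM.
have mv : measurable_fun setT v by exact: measurable_funM.
have me : measurable_fun setT e.
  rewrite (_ : e = fun X => (nu - 2) * (sqnorm (gram X) + nu^-1 * sqnorm (gram X *m X))
    + sqnorm X * (sqnorm X + nu^-1 * sqnorm (gram X))); last first.
    by apply/funext => X; exact: eE.
  have mkappa : measurable_fun setT (fun X : M => sqnorm (gram X *m X)).
    rewrite (_ : (fun X => _) = fun X : M => \tr (gram X *m gram X *m gram X)).
      apply: measurable_polyfun; apply: polyfun_tr.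
      by apply: polymxM; [apply: polymxM|]; exact: polymx_gram.
    by apply/funext => X; rewrite tr_gram3.
  apply: measurable_funD; apply: measurable_funM => //.
    by apply: measurable_funD => //; exact: measurable_funM.
  by apply: measurable_funD => //; exact: measurable_funM.
have tau0 := @sqnorm_ge0 R d m.
have vnu0 : 0 <= nu^-1 by rewrite invr_ge0 ltW.
have u0 X : 0 <= u X by rewrite mulr_ge0.
have v0 X : 0 <= v X by rewrite mulr_ge0 ?sqnorm_ge0// ltW.
have e0 X : 0 <= e X.
  rewrite eE; apply: addr_ge0; apply: mulr_ge0;
    rewrite ?sqnorm_ge0 ?(ltW nu2)//; apply: addr_ge0; rewrite ?sqnorm_ge0//;
    by apply: mulr_ge0; rewrite ?sqnorm_ge0.
have iu : Q.-integrable setT (EFin \o u).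
  rewrite (_ : _ \o _ = fun X => (b%:E * (sqnorm X)%:E)%E).
    exact: integrableZl.
  by apply/funext => X /=; rewrite EFinM.
pose C := ((nu - 2) + d%:R + (nu - 2) / nu + nu^-1) / k.
have eC X : e X <= C * (1 + sqnorm X) * (1 + v X).
  rewrite eE /v /C.
  have h1 := sqr_sqnorm_le X; have h2 : sqnorm (gram X *m X) <= _ := sqnorm_mul_le _ _.
  have s0 := sqnorm_ge0 (gram X); have t0 := tau0 X.
  move: h1 h2 s0 t0; set s := sqnorm (gram X); set t := sqnorm X.
  set q := sqnorm (gram X *m X) => h1 h2 s0 t0.
  have st0 : 0 <= s * t by rewrite mulr_ge0.
  set B := _ + nu^-1.
  have B0 : 0 <= B.
    have x1 : 0 <= (nu - 2) / nu by rewrite divr_ge0 ?(ltW nu2) ?(ltW nu_gt0).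
    by rewrite /B; do 3!apply: addr_ge0 => //; exact: ltW.
  apply: (@le_trans _ _ (B * (1 + t) * s)).
    have h3 : (nu - 2) * (nu^-1 * q) <= (nu - 2) * (nu^-1 * (s * t)).
      by rewrite ler_wpM2l ?(ltW nu2)// ler_wpM2l.
    have : 0 <= (nu - 2) * (s * t) by rewrite mulr_ge0// ltW.
    have : 0 <= (nu - 2) / nu * s.
      by rewrite mulr_ge0 ?divr_ge0 ?(ltW nu2) ?(ltW nu_gt0).
    have : 0 <= d%:R * (s * t) by rewrite mulr_ge0.
    have : 0 <= nu^-1 * s by rewrite mulr_ge0.
    rewrite /B => x1 x2 x3 x4.
    apply: (@le_trans _ _ ((nu - 2) * s + (nu - 2) * (nu^-1 * (s * t)) +
      d%:R * s + t * (nu^-1 * s))); first lra.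
    rewrite -subr_ge0 [leRHS](_ : _ = nu^-1 * s + d%:R * (s * t) +
      (nu - 2) / nu * s + (nu - 2) * (s * t)); last ring.
    by rewrite !addr_ge0.
  rewrite (_ : B / k * (1 + t) * (1 + k * s) =
    B * (1 + t) * s + B / k * (1 + t)); last by field; rewrite gt_eqF.
  rewrite lerDl; apply: mulr_ge0; last exact: addr_ge0.
  by apply: divr_ge0 => //; exact: ltW.
have iv := damped_integrable mtau mu_ mv tau0 u0 v0 e0 iu
  (fun delta d0 => (hf delta d0).1) (fun delta d0 => (hf delta d0).2).
have Ev := damped_integral mtau mu_ mv me tau0 u0 v0 e0 iu eC
  (fun delta d0 => (hf delta d0).1) (fun delta d0 => (hf delta d0).2).
have sigmaE (X : M) : (sqnorm (gram X))%:E = (k^-1%:E * (v X)%:E)%E.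
  by rewrite -EFinM mulKf ?gt_eqF.
under eq_integral do rewrite sigmaE.
rewrite integralZl// Ev /u.
under eq_integral do rewrite EFinM.
rewrite integralZl// Etau -!EFinM.
by congr EFin; rewrite /k /b; field; rewrite !gt_eqF.
Qed.

End moments.

(** * Whitening *)

Section whitening.
Context (R : realType) (d' m' : nat).
Notation d := d'.+1.
Notation m := m'.+1.
Notation M := 'M[R]_(d, m).
Variables (Sigma : 'M[R]_d) (Omega : 'M[R]_m).
Hypotheses (Sigma_pd : posdefmx Sigma) (Omega_pd : posdefmx Omega).

Let B := sqrtmx Sigma.
Let C := sqrtmx Omega.
Let Bpd : posdefmx B. Proof. by have [] := sqrtmxP Sigma_pd. Qed.
Let Cpd : posdefmx C. Proof. by have [] := sqrtmxP Omega_pd. Qed.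
Let Bu : B \in unitmx. Proof. exact: posdefmx_unitmx. Qed.
Let Cu : C \in unitmx. Proof. exact: posdefmx_unitmx. Qed.
Let BB : B *m B = Sigma. Proof. by have [] := sqrtmxP Sigma_pd. Qed.
Let CC : C *m C = Omega. Proof. by have [] := sqrtmxP Omega_pd. Qed.

Let phi (X : M) : M := Delta Sigma Omega X.
Let phi' (Y : M) : M := B *m Y *m C.

Let phiK : cancel phi phi'.
Proof. by move=> X; rewrite /phi /phi' /Delta mulmxA mulKVmx// mulmxKV. Qed.

Let phi'K : cancel phi' phi.
Proof. by move=> X; rewrite /phi /phi' /Delta mulmxA mulKmx// mulmxK. Qed.

Let measurable_mul_mx (A1 : 'M[R]_d) (A2 : 'M[R]_m) :
  measurable_fun [set: M] (fun X : M => A1 *m X *m A2 : M).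
Proof.
apply: measurable_fun_mx => i j; apply: measurable_polyfun.
have : polymx (fun X : M => A1 *m X *m A2).
  apply: polymxM; last exact: polymx_cst.
  by apply: polymxM; [exact: polymx_cst|exact: polymx_id].
exact.
Qed.

Let mphi : measurable_fun [set: M] phi.
Proof. exact: measurable_mul_mx. Qed.

Let mphi' : measurable_fun [set: M] phi'.
Proof. exact: measurable_mul_mx. Qed.

(* [invmx B] conjugates [Delta Delta^T] into [Sigma^-1 X Omega^-1 X^T]. *)
Lemma det_Delta nu (X : M) :
  \det (1%:M + nu^-1 *: (invmx Sigma *m X *m invmx Omega *m X^T)) =
  \det (Wmx nu (Delta Sigma Omega X)).
Proof.
have invBB : invmx Sigma = invmx B *m invmx B.
  by rewrite -BB; apply: (can_inj (mulKmx (_ : B *m B \in unitmx)));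
    rewrite ?unitmx_mul ?Bu// mulmxV ?unitmx_mul ?Bu// mulmxA mulmxK// mulmxV.
have invCC : invmx Omega = invmx C *m invmx C.
  by rewrite -CC; apply: (can_inj (mulKmx (_ : C *m C \in unitmx)));
    rewrite ?unitmx_mul ?Cu// mulmxV ?unitmx_mul ?Cu// mulmxA mulmxK// mulmxV.
have BT : (invmx B)^T = invmx B by rewrite trmx_inv Bpd.1.
have CT : (invmx C)^T = invmx C by rewrite trmx_inv Cpd.1.
have -> : 1%:M + nu^-1 *: (invmx Sigma *m X *m invmx Omega *m X^T) =
    invmx B *m Wmx nu (Delta Sigma Omega X) *m B.
  rewrite /Wmx mulmxDr mulmx1 mulmxDl mulVmx//; congr (_ + _).
  rewrite -scalemxAr -scalemxAl; congr (_ *: _).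
  rewrite /Delta -/B -/C !trmx_mul BT CT invBB invCC.
  by rewrite !mulmxA mulmxKV.
by rewrite !det_mulmx det_inv mulrC mulVKf// -unitfE -unitmxE.
Qed.

Let pushforward_shift (mu : {sigma_finite_measure set M -> \bar R})
    (muE : pushforward (@lebesgue_mx R d m) phi = mu :> (set M -> \bar R))
    (H : M) (A : set M) :
  measurable A -> mu ((fun X => X + H) @^-1` A) = mu A.
Proof.
move=> mA; rewrite -muE /pushforward.
rewrite -[RHS](lebesgue_mx_shift (phi' H)); last first.
  by rewrite -[X in measurable X]setTI; exact: mphi.
congr lebesgue_mx; apply/seteqP; split => X /=;
  suff -> : phi (X + phi' H) = phi X + H by [];
  by rewrite -[in RHS](phi'K H) /phi /Delta mulmxDr mulmxDl.
Qed.

Section law.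
Context disp (T : measurableType disp) (P : probability T R)
  (X : {RV P >-> M}) (nu : R).
Hypothesis nu_gt2 : 2 < nu.
Hypothesis Xlaw : has_matrixT_law X nu Sigma Omega.

Let nu_gt0 : 0 < nu. Proof. exact: lt_trans nu_gt2. Qed.

Let c : R := mvGamma_fun d ((nu + m%:R + d%:R - 1) / 2) /
  mvGamma_fun d ((nu + d%:R - 1) / 2) /
  ((nu * pi) `^ (m%:R * d%:R / 2) *
   (\det Sigma) `^ (m%:R / 2) * (\det Omega) `^ (d%:R / 2)).

Let p (Y : M) : R := c * \det (Wmx nu Y) `^ (- ((nu + m%:R + d%:R - 1) / 2)).

Let pdfE Y : matrixT_pdf nu Sigma Omega Y = p (phi Y).
Proof. by rewrite /matrixT_pdf det_Delta /p /c; ring. Qed.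

Let mp : measurable_fun [set: M] p.
Proof.
apply: measurable_funM => //; apply: (measurableT_comp (measurable_powR _)).
by apply: measurable_polyfun; apply: polyfun_det; exact: polymx_Wmx.
Qed.

Let c_ge0 : 0 <= c.
Proof.
rewrite leNgt; apply/negP => c0.
have := Xlaw measurableT; rewrite probability_setT.
have : (\int[@lebesgue_mx R d m]_(Y in setT) (matrixT_pdf nu Sigma Omega Y)%:E <= 0)%E.
  have pN Y : (0 <= (- matrixT_pdf nu Sigma Omega Y)%:E)%E.
    by rewrite lee_fin oppr_ge0 pdfE /p mulr_le0_ge0 ?powR_ge0// ltW.
  rewrite (eq_integral (fun Y => - (- matrixT_pdf nu Sigma Omega Y)%:E)%E).
    by rewrite integral_ge0N// oppe_le0 integral_ge0.
  by move=> Y _; rewrite -EFinN opprK.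
by move=> + E; rewrite -E lee_fin ler10.
Qed.

Let mDX : measurable_fun setT (phi \o X).
Proof. exact: measurableT_comp. Qed.

Let white_density : exists (mu : {sigma_finite_measure set M -> \bar R})
    (Q : probability M R),
  [/\ forall (H : M) (A : set M), measurable A ->
        mu ((fun X => X + H) @^-1` A) = mu A,
    forall A : set M, measurable A -> Q A = (\int[mu]_(Y in A) (p Y)%:E)%E &
    forall f : M -> R, measurable_fun setT f -> (forall Y, 0 <= f Y) ->
      ('E_P[fun w => f (phi (X w))] = \int[Q]_Y (f Y)%:E)%E].
Proof.
have [mu muE] := sigma_finite_pushforward (@lebesgue_mx R d m) mphi mphi' phiK.
have mDX' := isMeasurableFun.Build _ _ _ _ (phi \o X) mDX.
pose DX : {mfun T >-> M} := HB.pack (phi \o X) mDX'.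
exists mu, (distribution P DX); split.
- by move=> H A; exact: pushforward_shift.
- move=> A mA.
  have mA' : measurable (phi @^-1` A) by rewrite -[X in measurable X]setTI; exact: mphi.
  transitivity (distribution P X (phi @^-1` A)); first by [].
  rewrite Xlaw//.
  transitivity (\int[pushforward (@lebesgue_mx R d m) phi]_(Y in A) (p Y)%:E)%E.
    rewrite (ge0_integral_pushforward mphi)//.
    - by apply: eq_integral => Y _; rewrite pdfE.
    - exact/measurable_EFinP/measurable_funTS.
    - by move=> Y _; rewrite lee_fin mulr_ge0// powR_ge0.
  apply: eq_measure_integral => A' mA'' _.
  by have := congr1 (@^~ A') muE.
- move=> f mf f0; rewrite unlock ge0_integral_distribution//.
  exact/measurable_EFinP.
Qed.

Lemma expectation_tr_DeltaDeltaT :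
  ('E_P[fun w => \tr (DeltaDeltaT Sigma Omega (X w))] =
         (m%:R * d%:R * nu / (nu - 2))%:E)%E.
Proof.
have [mu [Q [mu_shift QE EQ]]] := white_density.
have [_ <-] := first_moment nu_gt2 mu_shift c_ge0 QE.
rewrite -EQ//; first by apply: measurable_polyfun; exact: polyfun_sqnorm.
by move=> Y; exact: sqnorm_ge0.
Qed.

Lemma expectation_tr_DeltaDeltaT2 : 4 < nu ->
  ('E_P[fun w => \tr (DeltaDeltaT Sigma Omega (X w) ^+ 2)] =
         (m%:R * d%:R * nu ^+ 2 *
          ((m%:R + d%:R) * (nu - 2) + nu + m%:R * d%:R) /
          ((nu - 1) * (nu - 2) * (nu - 4)))%:E)%E.
Proof.
move=> nu_gt4; have [mu [Q [mu_shift QE EQ]]] := white_density.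
rewrite -(second_moment nu_gt2 mu_shift c_ge0 QE nu_gt4) -EQ.
- by congr expectation; apply/funext => w; rewrite sqnorm_gram.
- apply: measurable_polyfun; apply: polyfun_tr; apply: polymxM;
    [|apply: polymx_tr]; exact: polymx_gram.
- by move=> Y; exact: sqnorm_ge0.
Qed.

End law.
End whitening.

Section asymptotics.
Context (R : realType).

Let cvg_inv_pinfty : (x : R)^-1 @[x --> +oo] --> (0 : R).
Proof.
apply/(gtr0_cvgV0 (f := id)); last exact: cvg_id.
exact: nbhs_pinfty_gt.
Qed.

Let cvg_lin (k : R) : (1 - k * x^-1) @[x --> +oo] --> (1 : R).
Proof.
rewrite -[X in _ --> X]subr0 -[X in _ - X](mulr0 k).
by apply: cvgB; [exact: cvg_cst|apply: cvgM => //; exact: cvg_cst].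
Qed.

Lemma asymp_equiv_moment1 (a : R -> \bar R) (q : R) :
  (forall nu, 2 < nu -> a nu = (q * nu / (nu - 2))%:E) -> asymp_equiv a (fun=> q).
Proof.
move=> aE; exists (fun nu => 2 * nu^-1 / (1 - 2 * nu^-1)).
  rewrite [X in _ --> X](_ : 0 = 2 * 0 / 1); last by rewrite mulr0 mul0r.
  apply: cvgM; first by apply: cvgM => //; exact: cvg_cst.
  by apply: cvgV => //; exact: oner_neq0.
near=> nu.
have nu2 : 2 < nu by near: nu; exact: nbhs_pinfty_gt.
rewrite aE//; congr EFin; field.
by rewrite !gt_eqF ?subr_gt0//; lra.
Unshelve. all: by end_near. Qed.

Lemma asymp_equiv_moment2 (a : R -> \bar R) (q s : R) : 0 <= s ->
  (forall nu, 4 < nu -> a nu = (q * nu ^+ 2 * (s * (nu - 2) + nu + q) /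
    ((nu - 1) * (nu - 2) * (nu - 4)))%:E) ->
  asymp_equiv a (fun=> q * (s + 1)).
Proof.
move=> s0 aE; have s1 : s + 1 != 0 by rewrite gt_eqF// ltr_wpDl.
exists (fun nu => ((s + 1) + (q - 2 * s) * nu^-1) /
  ((1 - 1 * nu^-1) * (1 - 2 * nu^-1) * (1 - 4 * nu^-1)) / (s + 1) - 1).
  rewrite [X in _ --> X](_ : 0 = ((s + 1) + (q - 2 * s) * 0) /
    (1 * 1 * 1) / (s + 1) - 1); last by field.
  apply: cvgB; last exact: cvg_cst.
  apply: cvgM; last exact: cvg_cst.
  apply: cvgM.
    by apply: cvgD; [exact: cvg_cst|apply: cvgM => //; exact: cvg_cst].
  apply: cvgV; first by rewrite !mulr1 oner_neq0.
  by apply: cvgM => //; apply: cvgM.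
near=> nu.
have nu4 : 4 < nu by near: nu; exact: nbhs_pinfty_gt.
rewrite aE//; congr EFin; field.
by rewrite s1 !gt_eqF//; lra.
Unshelve. all: by end_near. Qed.

End asymptotics.

Theorem lemma1 (R : realType) (d m : nat) (d_gt0 : (0 < d)%N)
  (m_gt0 : (0 < m)%N) (Sigma : 'M[R]_d) (Omega : 'M[R]_m)
  (Sigma_pd : posdefmx Sigma) (Omega_pd : posdefmx Omega) :
  [/\ forall (disp : measure_display) (T : measurableType disp)
          (P : probability T R) (X : {RV P >-> 'M[R]_(d, m)}) (nu : R),
        2 < nu -> has_matrixT_law X nu Sigma Omega ->
        ('E_P[fun w => \tr (DeltaDeltaT Sigma Omega (X w))] =
         (m%:R * d%:R * nu / (nu - 2))%:E)%E,
      forall (disp : measure_display) (T : measurableType disp)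
          (P : probability T R) (X : {RV P >-> 'M[R]_(d, m)}) (nu : R),
        4 < nu -> has_matrixT_law X nu Sigma Omega ->
        ('E_P[fun w => \tr (DeltaDeltaT Sigma Omega (X w) ^+ 2)] =
         (m%:R * d%:R * nu ^+ 2 *
          ((m%:R + d%:R) * (nu - 2) + nu + m%:R * d%:R) /
          ((nu - 1) * (nu - 2) * (nu - 4)))%:E)%E &
      forall (disp : R -> measure_display)
          (T : forall nu : R, measurableType (disp nu))
          (P : forall nu : R, probability (T nu) R)
          (X : forall nu : R, {RV (P nu) >-> 'M[R]_(d, m)}),
        (forall nu : R, 0 < nu -> has_matrixT_law (X nu) nu Sigma Omega) ->
        asymp_equiv
          (fun nu => 'E_(P nu)[fun w => \tr (DeltaDeltaT Sigma Omega (X nu w))])%E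
          (fun=> m%:R * d%:R) /\
        asymp_equiv
          (fun nu => 'E_(P nu)[fun w =>
             \tr (DeltaDeltaT Sigma Omega (X nu w) ^+ 2)])%E
          (fun=> m%:R * d%:R * (m%:R + d%:R + 1))].
Proof.
case: d d_gt0 Sigma Sigma_pd => // d' _ {}Sigma {}Sigma_pd.
case: m m_gt0 Omega Omega_pd => // m' _ {}Omega {}Omega_pd.
split.
- by move=> disp T P X nu nu2 Xlaw; exact: expectation_tr_DeltaDeltaT.
- move=> disp T P X nu nu4 Xlaw; apply: expectation_tr_DeltaDeltaT2 => //.
  by apply: lt_trans nu4; rewrite ltr_nat.
move=> disp T P X Xlaw; split.
  apply: asymp_equiv_moment1 => nu nu2.
  apply: expectation_tr_DeltaDeltaT => //; apply: Xlaw.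
  by apply: lt_trans nu2.
apply: asymp_equiv_moment2 => [|nu nu4]; first exact: addr_ge0.
apply: expectation_tr_DeltaDeltaT2 => //.
  by apply: lt_trans nu4; rewrite ltr_nat.
by apply: Xlaw; apply: lt_trans nu4.
Qed.
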